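(* If $k\in L^1_{\rm loc}(X)$ has an upper gradient $g_k\in L^1_{\rm loc}(X)$ and $c\in\mathbb{R}$, then $$g_{k\wedge c}=g_k\chi_{\{k<c\}}\quad\text{and}\quad g_{k\vee c}=g_k\chi_{\{k>c\}}$$ ($\mu$-a.e.), where $k\wedge c=\min\{k,c\}$ and $k\vee c=\max\{k,c\}$.
   Context: $(X,d_X,\mu)$ is a metric measure space: $(X,d_X)$ is a locally compact separable metric space and $\mu$ is a Borel regular measure with $0<\mu(B(x,r))<\infty$ for every ball. Elements of $L^1_{\rm loc}(X)$ (w.r.t. $\mu$) are identified if equal $\mu$-a.e. The space $\mathcal{M}$ and its metric. $\mathcal{M}$ is the set of all non-negative finite Borel measures $\nu$ on $X$ with compact support and $\nu\le\mu$; $\|\nu\|=\nu(X)$. Fix a strictly increasing continuous function $h:[0,\infty)\to[0,\infty)$ with $h(0)=\lim_{\varepsilon\to0^+}h(\varepsilon)/\varepsilon=0$, $h(\varepsilon_1)+h(\varepsilon_2)\le h(\varepsilon_1+\varepsilon_2)$ for all $\varepsilon_1,\varepsilon_2\ge0$, and $\lim_{\varepsilon\to\infty}h(\varepsilon)=\infty$. For $\nu,\eta\in\mathcal{M}$ and $\varepsilon,\delta>0$, $\Gamma_{\varepsilon,\delta}(\nu,\eta)$ is the set of families $(\nu_i,\eta_i)_{i\in\mathbb{M}}$ with $\mathbb{M}$ at most countable, $\nu_i,\eta_i\in\mathcal{M}$, $\nu=\sum_i\nu_i$, $\eta=\sum_i\eta_i$, $\sum_i\bigl|\|\nu_i\|-\|\eta_i\|\bigr|\le\delta$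 and $\mathrm{diam}(\mathrm{supp}(\nu_i)\cup\mathrm{supp}(\eta_i))\le\varepsilon$ for each $i$ (the support of the zero measure is empty and $\mathrm{diam}(\emptyset)=0$). Put $d_{\mathcal{M}}(\nu,\eta)=\inf\{\varepsilon>0:\Gamma_{\varepsilon,h(\varepsilon)}(\nu,\eta)\ne\emptyset\}$; this is a metric on $\mathcal{M}$. Let $\mathcal{X}=\mathcal{M}\setminus\{0\}$ with the induced metric. $\widetilde{\mathcal{R}}(\mathcal{X})$ is the set of all $1$-Lipschitz maps $\nu:[0,b_\nu]\to\mathcal{X}$, $0\le b_\nu<\infty$. For $F:\mathcal{X}\to\mathbb{R}$ and $\varepsilon>0$ let $r_F^\varepsilon(\eta)=\sup\{|F(\nu(s))-F(\eta)|/s:\nu\in\widetilde{\mathcal{R}}(\mathcal{X}),\ \nu(0)=\eta,\ 0<s<\min(\varepsilon,b_\nu)\}$ and $r_F(\eta)=\lim_{\varepsilon\to0}r_F^\varepsilon(\eta)\in[0,\infty]$. For $f\in L^1_{\rm loc}(X)$, $F_f:\mathcal{X}\to\mathbb{R}$ is $F_f(\eta)=\frac1{\|\eta\|}\int f\,d\eta$. If there is a function $g_f\in L^1_{\rm loc}(X)$ with $r_{F_f}(\eta)=F_{g_f}(\eta)$ for all $\eta\in\mathcal{X}$, it is $\mu$-a.e. unique and is called the upper gradient of $f$; one says that $f$ has an upper gradient $g_f\in L^1_{\rm loc}(X)$. The asserted equalities include the existence of the upper gradients on the left-hand sides. *)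

(* Defs.v *)
From HB Require Import structures.
From mathcomp Require Import all_boot all_order all_algebra.
From mathcomp Require Import all_classical all_reals all_analysis.

Set Implicit Arguments.
Unset Strict Implicit.
Unset Printing Implicit Defensive.

Import Order.TTheory GRing.Theory Num.Theory.
Import numFieldNormedType.Exports.

Local Open Scope classical_set_scope.
Local Open Scope ring_scope.

(* A metric space that also carries a sigma-algebra; that the latter is the
   Borel one is a hypothesis, see [metric_measure_space].  MathComp's
   [measurableType] is pointed, so the space is nonempty. *)
#[short(type="measurableMetricType")]
HB.structure Definition MeasurableMetric (d : measure_display)
    (R : numDomainType) :=
  {T of Measurable d T & Metric R T}.

Section Defs.
Context {R : realType} {d : measure_display} {X : measurableMetricType d R}.
Local Notation meas := {measure set X -> \bar R}.

(* [mu] gives the values on Borel sets of a Borel regular (outer) measure, and [mu^*%mu] its values on all subsets of [X]; every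
   mu^*-measurable function agrees mu-a.e. with a Borel one. *)
Record metric_measure_space (mu : meas) : Prop := {
  mms_borel : (measurable : set (set X)) = <<s (@open X) >> ;
  mms_separable : exists2 D : set X, countable D & dense D ;
  mms_locally_compact : locally_compact [set: X] ;
  mms_regular : forall A : set X,
    exists B : set X, [/\ measurable B, A `<=` B & mu B = (mu^*)%mu A] ;
  mms_ball : forall (x : X) (r : R), 0 < r -> (0 < mu (ball x r) < +oo)%E }.

Definition L1loc (mu : meas) (f : X -> R) : Prop :=
  measurable_fun [set: X] f /\
  forall K : set X, compact K -> (\int[mu]_(x in K) `|f x|%:E < +oo)%E.

Definition supp (nu : meas) : set X :=
  [set x | forall U : set X, open U -> U x -> (0 < nu U)%E].

(* The element 0 is added so that the diameter of the empty set is 0. *)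
Definition diam (A : set X) : \bar R :=
  ereal_sup ([set 0%E] `|` [set (mdist x y)%:E | x in A & y in A]).

(* A term of type [meas] also has (meaningless) values on nonmeasurable sets,
   hence equality of measures below is always tested on measurable sets. *)
Definition inM (mu nu : meas) : Prop :=
  [/\ (nu setT < +oo)%E, compact (supp nu) &
      forall A : set X, measurable A -> (nu A <= mu A)%E].

Definition inX (mu nu : meas) : Prop := inM mu nu /\ nu setT != 0%E.

Record gauge (h : R -> R) : Prop := {
  gauge_ge0 : forall e : R, 0 <= e -> 0 <= h e ;
  gauge_incr : forall e1 e2 : R, 0 <= e1 -> e1 < e2 -> h e1 < h e2 ;
  gauge_cont : {within `[0, +oo[, continuous h} ;
  gauge0 : h 0 = 0 ;
  gauge_deriv0 : h e / e @[e --> 0^'+] --> (0 : R) ;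
  gauge_superadd : forall e1 e2 : R, 0 <= e1 -> 0 <= e2 ->
    h e1 + h e2 <= h (e1 + e2) ;
  gauge_infty : h e @[e --> +oo] --> +oo }.

(* The index set of a family is any subset [I] of [nat], so it is at most
   countable; values of [nu_] and [eta_] outside [I] are irrelevant. *)
Definition Gamma (mu : meas) (e delta : R) (nu eta : meas)
    (I : set nat) (nu_ eta_ : nat -> meas) : Prop :=
  [/\ forall i, I i -> inM mu (nu_ i) /\ inM mu (eta_ i),
      forall A : set X, measurable A ->
        nu A = \esum_(i in I) nu_ i A /\ eta A = \esum_(i in I) eta_ i A,
      (\esum_(i in I) `|nu_ i setT - eta_ i setT| <= delta%:E)%E &
      forall i, I i -> (diam (supp (nu_ i) `|` supp (eta_ i)) <= e%:E)%E].

Definition dM (mu : meas) (h : R -> R) (nu eta : meas) : \bar R :=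
  ereal_inf [set e%:E | e in
    [set e : R | 0 < e /\ exists I nu_ eta_, Gamma mu e (h e) nu eta I nu_ eta_]].

Definition lip_curve (mu : meas) (h : R -> R) (b : R) (nu : R -> meas) : Prop :=
  [/\ 0 <= b, forall t : R, 0 <= t <= b -> inX mu (nu t) &
      forall s t : R, 0 <= s <= b -> 0 <= t <= b ->
        (dM mu h (nu s) (nu t) <= `|s - t|%:E)%E].

Definition r_eps (mu : meas) (h : R -> R) (F : meas -> R) (eta : meas) (e : R)
    : \bar R :=
  ereal_sup [set z | exists b nu s,
    [/\ lip_curve mu h b nu,
        forall A : set X, measurable A -> nu 0 A = eta A,
        0 < s < Num.min e b &
        z = (`|F (nu s) - F eta| / s)%:E]].

Definition r_lim (mu : meas) (h : R -> R) (F : meas -> R) (eta : meas)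
    : \bar R :=
  lim (r_eps mu h F eta e @[e --> 0^'+]).

Definition Favg (f : X -> R) (eta : meas) : R :=
  (fine (eta setT))^-1 * \int[eta]_x f x.

Definition upper_gradient (mu : meas) (h : R -> R) (f g : X -> R) : Prop :=
  [/\ L1loc mu f, L1loc mu g &
      forall eta : meas, inX mu eta ->
        r_lim mu h (Favg f) eta = (Favg g eta)%:E].

(* "g_f = g mu-a.e.", including the existence of g_f: the upper gradient exists
   and each of its representatives is a.e. equal to [g]. *)
Definition upper_gradient_is (mu : meas) (h : R -> R) (f g : X -> R) : Prop :=
  (exists g', upper_gradient mu h f g') /\
  (forall g', upper_gradient mu h f g' -> {ae mu, forall x, g' x = g x}).

End Defs.

(* Main.v *)
From HB Require Import structures.
Require Import Defs.
From mathcomp Require Import all_boot all_order all_algebra.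
From mathcomp Require finmap.
From mathcomp Require Import all_classical all_reals all_analysis.
From mathcomp Require Import measurable_realfun ring lra.
Import Order.TTheory GRing.Theory Num.Theory.
Import numFieldNormedType.Exports.
Local Open Scope classical_set_scope.
Local Open Scope ring_scope.

(** Along a Lipschitz curve in the space of measures a step of length [e] may lose
the mass [h e], which is small compared with [e]. Cutting a time interval into
many steps therefore shows that nothing is lost: between the times [s] and [t]
every unit of mass is merely moved by a distance of at most [|t - s|]
([lip_curve_moves]). Conversely a family of nonzero measures that moves in this
way is a Lipschitz curve ([moves_dM]). The speed is a property of the motion of
the mass, and it passes to parts of it: if [nu 0 = al + be], the whole curve
splits as [nu t = A t + B t], where [A] starts from [al], [B] starts from [be] and
both move at unit speed ([moving_curve_split]).

With such splittings truncation becomes transparent. Let [phi = min k c] and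
[E = {k < c}], and split a curve that starts from [eta] into four parts, according
to whether the mass starts in [E] and whether it is in [E] at the time [s]. On
each part the integral of [phi] changes by at most as much as the integral of [k],
and not at all on the part that is outside [E] at both ends ([phi_increment]). The
part that enters [E] has small mass if [s] is small, because transport over a
small distance hardly changes the mass of [E], uniformly in the measures
([stable_meas]). The slope of the integral of [k] along a part is the integral of
[gk] with respect to this part, so the increment of [k] up to the time [s] is at
most [s] times the largest integral of [|gk|] met on the way ([increment]). For the
parts that start in [E] this integral is close to its initial value
([int_moves]), for the part that enters [E] it is small with the mass
([int_small]). Altogether the slope of [phi] at [eta] is at most the integral of
[gk] over [E] with respect to [eta] ([upper_slope]).

Applied to [- k] this bounds the slope of [max k c] by the integral of [gk] over
[{k > c}]. Now [min k c + max k c = k + c], and the slope of [k] is the integral of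
[gk], which is at least the sum of the two bounds. Hence both bounds are attained
([r_lim_complementary]). The measures of the space separate locally integrable
functions up to null sets ([ae_le_of_integral]), which gives [gk >= 0] almost
everywhere and the uniqueness of the upper gradients. *)
Set Implicit Arguments.
Unset Strict Implicit.
Unset Printing Implicit Defensive.

(** * Facts on the real line *)

Lemma at_right0_ex (R : realType) (P : set R) :
  (\forall e \near 0^'+, P e) -> exists2 q, 0 < q & forall e, 0 < e < q -> P e.
Proof.
move=> H; have [q /= q0 qH] := (@nbhs_ballP R R 0 [set u | 0 < u -> P u]).1 H.
exists q => // e /andP[e0 eq]; apply: qH => //=.
by rewrite /ball/= sub0r normrN gtr0_norm.
Qed.

Lemma invSn_lt (R : realType) (e : R) : 0 < e -> exists n : nat, n.+1%:R^-1 < e :> R.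
Proof.
move=> e0; exists (Num.bound e^-1); rewrite invf_plt ?posrE//.
have e1 : 0 <= e^-1 by rewrite invr_ge0 ltW.
by apply: lt_trans (archi_boundP e1) _; rewrite ltr_nat.
Qed.

(** The supremum of the times up to which the bound holds is reached, by the local
bound on its left, and by the local bound on its right it cannot be smaller
than [s]. *)
Lemma local_lipschitz (R : realType) (phi : R -> R) (s L : R) : 0 <= s ->
  (forall t, 0 <= t <= s -> exists2 e, 0 < e & forall t', 0 <= t' <= s ->
     `|t' - t| < e -> `|phi t' - phi t| <= L * `|t' - t|) ->
  `|phi s - phi 0| <= L * s.
Proof.
move=> s0 loc.
pose S := [set t | 0 <= t <= s /\ `|phi t - phi 0| <= L * t].
have S0 : S 0 by rewrite /S/= lexx s0 subrr normr0 mulr0.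
have hS : has_sup S by split; [exists 0|exists s => t [/andP[]]].
have ubS t : S t -> t <= sup S by exact: sup_upper_bound.
have T0 : 0 <= sup S by exact: ubS.
have Ts : sup S <= s by apply: ge_sup; [exists 0|move=> t [/andP[]]].
have [e e0 H] := loc (sup S) (introT andP (conj T0 Ts)).
have [t St tS] := sup_adherent e0 hS.
have [tS0 tphi] := St; have tT := ubS _ St.
have near_ t' : 0 <= t' <= s -> `|t' - sup S| < e -> sup S <= t' -> S t'.
  move=> t's t'e Tt'; split => //.
  have h1 := H _ t's t'e.
  have te : `|t - sup S| < e by rewrite distrC ger0_norm ?subr_ge0//; lra.
  have h2 := H _ tS0 te.
  move: h1 h2; rewrite (ger0_norm (x := t' - _)) ?subr_ge0//.
  rewrite (distrC t) (ger0_norm (x := sup S - _)) ?subr_ge0//.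
  move: tphi; rewrite !ler_norml => /andP[a1 a2] /andP[b1 b2] /andP[c1 c2].
  by apply/andP; split; lra.
have ST : S (sup S).
  by apply: near_ => //; [rewrite T0|rewrite subrr normr0].
suff sE : sup S = s by rewrite -sE; exact: ST.2.
apply/eqP; rewrite eq_le Ts/=; rewrite leNgt; apply/negP => Tlt.
pose t' := Num.min (sup S + e / 2) s.
have t'T : sup S < t' by rewrite lt_min Tlt andbT ltrDl divr_gt0.
have : S t'.
  apply: near_; last exact: ltW.
    by rewrite (le_trans T0 (ltW t'T))/= ge_min lexx orbT.
  rewrite gtr0_norm ?subr_gt0// ltrBlDl.
  by apply: (@le_lt_trans _ _ (sup S + e / 2)); [rewrite ge_min lexx|rewrite ltrD2l; lra].
by move=> /ubS; rewrite leNgt t'T.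
Qed.

Lemma max0_lip (R : realType) (x y : R) :
  `|Num.max 0 x - Num.max 0 y| <= `|x - y|.
Proof.
have := ler_norm (x - y); have := ler_norm (y - x); rewrite (distrC y x).
move: (`|x - y|) => N h1 h2; rewrite ler_norml.
by case: (leP 0 x) => ?; case: (leP 0 y) => ?; apply/andP; split; lra.
Qed.

Lemma mins_lip (R : realType) (s x y : R) :
  `|Num.min x s - Num.min y s| <= `|x - y|.
Proof.
have := ler_norm (x - y); have := ler_norm (y - x); rewrite (distrC y x).
move: (`|x - y|) => N h1 h2; rewrite ler_norml.
by case: (leP x s) => ?; case: (leP y s) => ?; apply/andP; split; lra.
Qed.

(** * Finite transportation problems *)

Section FiniteTransport.
Context {R : realFieldType} {I J : finType} (e : I -> J -> bool).

Definition nbrs (S : {set I}) : {set J} := [set j | [exists i in S, e i j]]%SET.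

Definition hall (a : I -> R) (b : J -> R) :=
  forall S : {set I}, \sum_(i in S) a i <= \sum_(j in nbrs S) b j.

Lemma nbrsS (S T : {set I}) : S \subset T -> nbrs S \subset nbrs T.
Proof.
move=> /fintype.subsetP ST; apply/fintype.subsetP => j.
rewrite !inE => /exists_inP[i iS eij].
by apply/exists_inP; exists i => //; exact: ST.
Qed.

Lemma nbrsU (S T : {set I}) : nbrs (S :|: T) = nbrs S :|: nbrs T.
Proof.
apply/finset.setP => j; rewrite !inE; apply/exists_inP/orP => [[i]|].
  rewrite inE => /orP[iS|iT] eij; [left|right]; apply/exists_inP; by exists i.
by move=> [] /exists_inP[i iS eij]; exists i => //; rewrite inE iS ?orbT.
Qed.

Let nnz (K : finType) (f : K -> R) := #|[set i | f i != 0]%SET|.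

Lemma sum_sub (K : finType) (S : {set K}) (f : K -> R) (i : K) (t : R) :
  \sum_(k in S) (f k - (if k == i then t else 0)) =
  \sum_(k in S) f k - (if i \in S then t else 0).
Proof.
rewrite sumrB; congr (_ - _); rewrite -big_mkcondr /=.
case: ifP => iS.
  by rewrite (big_pred1 i)// => k; apply/andP/eqP => [[_ /eqP]//|->]; rewrite iS.
by rewrite big_pred0// => k; apply/negbTE/negP => /andP[kS /eqP ki]; rewrite -ki kS in iS.
Qed.

Lemma sum_restr (K : finType) (S T : {set K}) (f : K -> R) :
  \sum_(k in T) (if k \in S then f k else 0) = \sum_(k in T :&: S) f k.
Proof.
by rewrite -big_mkcondr; apply: eq_bigl => k; rewrite inE.
Qed.

(** A weighted marriage theorem. As much mass as possible is sent along one edge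
[(i, j)]: then an end of the edge is exhausted, or Hall's condition becomes an
equality for some set [S] that sees [j] and misses [i]. In the latter case the
problem decouples into [S] with its neighbours and the two complements, in both
of which fewer weights are nonzero. *)
Lemma finite_transport (a : I -> R) (b : J -> R) :
  (forall i, 0 <= a i) -> (forall j, 0 <= b j) ->
  \sum_i a i = \sum_j b j -> hall a b ->
  exists m : I -> J -> R, [/\ forall i j, 0 <= m i j,
    forall i, \sum_j m i j = a i, forall j, \sum_i m i j = b j &
    forall i j, m i j != 0 -> e i j].
Proof.
have [n] := ubnP (nnz a + nnz b)%N.
elim: n a b => // n IH a b; rewrite ltnS => len a0 b0 ab hab.
have [az|] := boolP [forall i, a i == 0].
  have az' i : a i = 0 by apply/eqP; exact: (forallP az).
  exists (fun _ _ => 0); split => //.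
  - by move=> i; rewrite az' big1.
  - move=> j; rewrite big1//; apply/esym/eqP; move: ab; rewrite big1//.
    by move/esym/psumr_eq0P => ->//; rewrite eqxx.
  - by move=> i j; rewrite eqxx.
move=> /forallPn[i ai0].
have ai : 0 < a i by rewrite lt_neqAle eq_sym ai0 a0.
have [j [eij bj]] : exists j, e i j /\ 0 < b j.
  have := hab [set i]%SET; rewrite finset.big_set1 => H.
  have : 0 < \sum_(j in nbrs [set i]%SET) b j by exact: lt_le_trans H.
  move=> /lt0r_neq0; rewrite psumr_neq0// => /hasP[j _ /andP[+ bj]].
  by rewrite inE => /exists_inP[i' /finset.set1P -> eij]; exists j.
pose crit := [pred S : {set I} | (i \notin S) && (j \in nbrs S)].
pose gap (S : {set I}) := \sum_(j in nbrs S) b j - \sum_(i in S) a i.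
have gap0 S : 0 <= gap S by rewrite subr_ge0.
(* Hall's condition for the remaining weights can only fail for the sets in
   [crit], which lose an amount [t] on the right and nothing on the left. *)
have [t [t0 tai tbj tgap tight]] : exists t, [/\ 0 <= t, t <= a i, t <= b j,
    (forall S, crit S -> t <= gap S) &
    [\/ t = a i, t = b j | exists2 S, crit S & t = gap S]].
  pose t0 := Num.min (a i) (b j).
  have t0ge : 0 <= t0 by rewrite le_min !ltW.
  have t0c : t0 = a i \/ t0 = b j by rewrite /t0; case: (leP (a i) (b j)); [left|right].
  have [/existsP[S0 cS0]|/existsPn nS] := boolP [exists S, crit S].
    pose S1 := [arg min_(S < S0 | crit S) gap S]%O.
    have [S1c S1m] : crit S1 /\ forall S, crit S -> gap S1 <= gap S.
      by rewrite /S1; case: arg_minP.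
    have [ts|st] := leP t0 (gap S1).
      exists t0; split => //; rewrite ?ge_min ?lexx ?orbT//.
        by move=> S /S1m; exact: le_trans.
      by case: t0c; [constructor 1|constructor 2].
    exists (gap S1); split => //.
    - by rewrite (le_trans (ltW st))// /t0 ge_min lexx.
    - by rewrite (le_trans (ltW st))// /t0 ge_min lexx orbT.
    - by constructor 3; exists S1.
  exists t0; split => //; rewrite ?ge_min ?lexx ?orbT//.
    by move=> S cS; move: (nS S); rewrite cS.
  by case: t0c; [constructor 1|constructor 2].
pose a' k := a k - (if k == i then t else 0).
pose b' k := b k - (if k == j then t else 0).
have a'0 k : 0 <= a' k by rewrite /a'; case: eqP => [->|_]; rewrite subr_ge0.
have b'0 k : 0 <= b' k by rewrite /b'; case: eqP => [->|_]; rewrite subr_ge0.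
have h' : hall a' b'.
  move=> S; rewrite !sum_sub; have := hab S.
  case: (boolP (i \in S)) => iS; case: (boolP (j \in nbrs S)) => jS H; rewrite ?subr0//.
  - by rewrite lerD2r.
  - by rewrite lerBlDr (le_trans H)// lerDl.
  - by have := tgap S; rewrite /= iS jS /gap => /(_ isT); lra.
have ab' : \sum_k a' k = \sum_k b' k.
  by rewrite /a' /b' !sumrB -!big_mkcond !big_pred1_eq ab.
have sa : (nnz a' <= nnz a)%N.
  apply/subset_leq_card/fintype.subsetP => k; rewrite !inE /a'.
  by case: (eqVneq k i) => [-> _|_]; [rewrite gt_eqF|rewrite subr0].
have sb : (nnz b' <= nnz b)%N.
  apply/subset_leq_card/fintype.subsetP => k; rewrite !inE /b'.
  by case: (eqVneq k j) => [-> _|_]; [rewrite gt_eqF|rewrite subr0].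
suff [m [m0 m1 m2 m3]] : exists m : I -> J -> R, [/\ forall i j, 0 <= m i j,
    forall i, \sum_j m i j = a' i, forall j, \sum_i m i j = b' j &
    forall i j, m i j != 0 -> e i j].
  exists (fun k l => m k l + (if (k == i) && (l == j) then t else 0)); split.
  - by move=> k l; rewrite addr_ge0//; case: ifP.
  - move=> k; rewrite big_split/= m1 /a'; case: eqP => /= [->|_].
      by rewrite -big_mkcond big_pred1_eq subrK.
    by rewrite big1// addr0 subr0.
  - move=> l; rewrite big_split/= m2 /b'; case: (eqVneq l j) => /= [->|_].
      under eq_bigr do rewrite andbT.
      by rewrite -big_mkcond big_pred1_eq subrK.
    by rewrite big1 ?addr0 ?subr0// => k _; rewrite andbF.
  - move=> k l; case: ifP => [/andP[/eqP-> /eqP->]//|_]; rewrite addr0; exact: m3.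
have [/eqP ta|nta] := boolP (t == a i).
  apply: IH => //; apply: leq_trans len; rewrite -addSn leq_add//.
  apply/proper_card/fintype.properP; split.
    apply/fintype.subsetP => k; rewrite !inE /a'.
    by case: (eqVneq k i) => [-> _|_]; [rewrite gt_eqF|rewrite subr0].
  by exists i; rewrite !inE; [by rewrite gt_eqF|by rewrite /a' eqxx ta subrr eqxx].
have [/eqP tb|ntb] := boolP (t == b j).
  apply: IH => //; apply: leq_trans len; rewrite -addnS leq_add//.
  apply/proper_card/fintype.properP; split.
    apply/fintype.subsetP => k; rewrite !inE /b'.
    by case: (eqVneq k j) => [-> _|_]; [rewrite gt_eqF|rewrite subr0].
  by exists j; rewrite !inE; [by rewrite gt_eqF|by rewrite /b' eqxx tb subrr eqxx].
case: tight => [/eqP|/eqP|]; rewrite ?(negbTE nta) ?(negbTE ntb)//.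
move=> [S /andP[/= iS jS] tS].
have tightS : \sum_(k in S) a' k = \sum_(k in nbrs S) b' k.
  rewrite !sum_sub jS (negbTE iS) tS /gap; lra.
pose a1 k := if k \in S then a' k else 0.
pose b1 k := if k \in nbrs S then b' k else 0.
pose a2 k := if k \in ~: S then a' k else 0.
pose b2 k := if k \in ~: nbrs S then b' k else 0.
have a'i : a' i != 0 by rewrite /a' eqxx subr_eq0 eq_sym.
have b'j : b' j != 0 by rewrite /b' eqxx subr_eq0 eq_sym.
have [||||p1|m1 [m10 m11 m12 m13]] := IH a1 b1.
- apply: leq_trans len; rewrite -addSn leq_add//.
    apply: leq_trans sa; apply/proper_card/fintype.properP; split.
      by apply/fintype.subsetP => k; rewrite !inE /a1; case: ifP; rewrite ?eqxx.
    by exists i; rewrite !inE// /a1 (negbTE iS) eqxx.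
  apply: leq_trans sb; apply/subset_leq_card/fintype.subsetP => k.
  by rewrite !inE /b1; case: ifP; rewrite ?eqxx.
- by move=> k; rewrite /a1; case: ifP.
- by move=> k; rewrite /b1; case: ifP.
- by rewrite /a1 /b1 -!big_mkcond.
- rewrite sum_restr [leRHS]sum_restr.
  apply: le_trans (h' _) _.
  rewrite [leRHS](bigID [in nbrs (p1 :&: S)])/= -[leLHS]addr0 lerD//; last first.
    by rewrite sumr_ge0.
  rewrite le_eqVlt; apply/orP; left; apply/eqP; apply: eq_bigl => k.
  apply/idP/andP => [kp|[]//]; split => //; rewrite inE.
  rewrite (fintype.subsetP (nbrsS (finset.subsetIl p1 S)))//.
  by rewrite (fintype.subsetP (nbrsS (finset.subsetIr p1 S))).
have [||||p2|m2 [m20 m21 m22 m23]] := IH a2 b2.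
- apply: leq_trans len; rewrite -addnS leq_add//.
    apply: leq_trans sa; apply/subset_leq_card/fintype.subsetP => k.
    by rewrite inE [in X in _ -> X]inE /a2; case: ifP; rewrite ?eqxx.
  apply: leq_trans sb; apply/proper_card/fintype.properP; split.
    by apply/fintype.subsetP => k; rewrite inE [in X in _ -> X]inE /b2; case: ifP; rewrite ?eqxx.
  by exists j; rewrite inE// /b2 inE jS eqxx.
- by move=> k; rewrite /a2; case: ifP.
- by move=> k; rewrite /b2; case: ifP.
- rewrite /a2 /b2 -!big_mkcond/=.
  move: ab'; rewrite (bigID [in S])/= [in X in _ = X](bigID [in nbrs S])/= tightS => /addrI E.
  rewrite (eq_bigl [predC S]); last by move=> k; rewrite inE.
  by rewrite E; apply: eq_bigl => k; rewrite finset.in_setC.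
- rewrite sum_restr [leRHS]sum_restr.
  have := h' (p2 :|: S); rewrite nbrsU.
  rewrite (bigID [in S])/= [leRHS](bigID [in nbrs S])/=.
  rewrite (eq_bigl [in S]); last first.
    by move=> k; rewrite !inE andb_orl andbb orbC; case: (k \in S); rewrite ?andbF.
  rewrite [X in _ <= X + _](eq_bigl [in nbrs S]); last first.
    by move=> k; rewrite finset.in_setU; case: (k \in nbrs S); rewrite ?andbF ?orbT.
  rewrite tightS lerD2l.
  rewrite (eq_bigl [in p2 :&: ~: S]); last first.
    by move=> k; rewrite !inE; case: (k \in S); rewrite ?andbF ?orbF.
  rewrite [X in _ <= X -> _](eq_bigl [in nbrs p2 :&: ~: nbrs S])//.
  move=> k; rewrite finset.in_setU finset.in_setI finset.in_setC.
  by case: (k \in nbrs S); rewrite ?andbF ?orbF.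
exists (fun k l => m1 k l + m2 k l); split.
- by move=> k l; rewrite addr_ge0.
- move=> k; rewrite big_split/= m11 m21 /a1 /a2 inE; case: ifP => _ /=; lra.
- move=> k; rewrite big_split/= m12 m22 /b1 /b2 finset.in_setC; case: ifP => _ /=; lra.
- move=> k l H; have [/m13//|] := boolP (m1 k l != 0); rewrite negbK => /eqP z.
  by apply: m23; move: H; rewrite z add0r.
Qed.

End FiniteTransport.

(** * Transport of measures over a bounded distance *)

Section Transport.
Context {R : realType} {d : measure_display} {X : measurableMetricType d R}.
Local Notation meas := {measure set X -> \bar R}.
Implicit Types (al be nu : meas) (A B : set X) (r : R).

Definition nbd r A : set X := [set y | exists2 x, A x & mdist x y < r].

(** By Strassen's theorem, for measures on a compact set this amounts to a coupling
of [al] and [be] that moves no mass further than [r]. In this form the relation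
passes to setwise limits of measures, and for [r > 0] it contains the equality of
the total masses, as [setT] is then its own neighbourhood. *)
Definition moves r al be := forall A, measurable A ->
  (al A <= be (nbd r A))%E /\ (be A <= al (nbd r A))%E.

Definition eqm al be := forall A, measurable A -> al A = be A.

Context (borel : (measurable : set (set X)) = <<s @open X >>).

Lemma open_borel A : open A -> measurable A.
Proof. by move=> oA; rewrite borel; exact: sub_sigma_algebra. Qed.

Lemma closed_borel A : closed A -> measurable A.
Proof.
by move=> cA; rewrite -(setCK A); apply/measurableC/open_borel/closed_openC.
Qed.

Lemma compact_borel A : compact A -> measurable A.
Proof. by move=> /(compact_closed (@metric_hausdorff R X))/closed_borel. Qed.

Lemma ball_open_metric (x : X) r : open [set y | mdist x y < r].
Proof.
rewrite openE => y /= xy; apply/nbhs_ballP; exists (r - mdist x y) => /=.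
  by rewrite subr_gt0.
move=> z; rewrite ballEmdist /= => yz.
by rewrite (le_lt_trans (metric_triangle _ y _))// -ltrBrDl.
Qed.

Lemma nbd_open r A : open (nbd r A).
Proof.
rewrite (_ : nbd r A = \bigcup_(x in A) [set y | mdist x y < r]).
  by apply: bigcup_open => x _; exact: ball_open_metric.
by apply/seteqP; split => [y [x Ax xy]|y [x Ax xy]]; exists x.
Qed.

Lemma nbd_meas r A : measurable (nbd r A).
Proof. exact/open_borel/nbd_open. Qed.

Lemma sub_nbd r A : 0 < r -> A `<=` nbd r A.
Proof. by move=> r0 x Ax; exists x => //; rewrite mdistxx. Qed.

Lemma nbd_nbd r r' A : nbd r' (nbd r A) `<=` nbd (r + r') A.
Proof.
move=> z [y [x Ax xy] yz]; exists x => //.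
by rewrite (le_lt_trans (metric_triangle _ y _))// ltrD.
Qed.

Lemma nbd_le r r' A : r <= r' -> nbd r A `<=` nbd r' A.
Proof. by move=> rr y [x Ax xy]; exists x => //; exact: lt_le_trans rr. Qed.

Lemma meas_mono al A B : measurable A -> measurable B -> A `<=` B -> (al A <= al B)%E.
Proof. by move=> mA mB AB; apply: le_measure => //; rewrite inE. Qed.

Lemma meas_setU2 al A B : measurable A -> measurable B ->
  (al (A `|` B) <= al A + al B)%E.
Proof. exact: measureU2. Qed.

Lemma meas_setU al A B : measurable A -> measurable B -> A `&` B = set0 ->
  (al (A `|` B) = al A + al B)%E.
Proof. exact: measureU. Qed.

Lemma moves_sym r al be : moves r al be -> moves r be al.
Proof. by move=> ab A mA; have [] := ab A mA. Qed.

Lemma moves_le r r' al be : r <= r' -> moves r al be -> moves r' al be.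
Proof.
move=> rr ab A mA; have [h1 h2] := ab A mA.
by split; [apply: le_trans h1 _|apply: le_trans h2 _]; apply: meas_mono;
  try exact: nbd_meas; exact: nbd_le.
Qed.

Lemma moves_refl r al : 0 < r -> moves r al al.
Proof.
by move=> r0 A mA; split; apply: meas_mono => //; try exact: nbd_meas; exact: sub_nbd.
Qed.

Lemma moves_trans r r' al be nu :
  moves r al be -> moves r' be nu -> moves (r + r') al nu.
Proof.
move=> ab bn A mA; split.
  have [h1 _] := ab A mA; apply: le_trans h1 _.
  have [h2 _] := bn _ (nbd_meas r A); apply: le_trans h2 _.
  by apply: meas_mono; try exact: nbd_meas; exact: nbd_nbd.
have [_ h1] := bn A mA; apply: le_trans h1 _.
have [_ h2] := ab _ (nbd_meas r' A); apply: le_trans h2 _.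
by apply: meas_mono; try exact: nbd_meas; rewrite addrC; exact: nbd_nbd.
Qed.

Lemma moves_mass r al be : 0 < r -> moves r al be -> al setT = be setT.
Proof.
move=> r0 ab; have [h1 h2] := ab _ measurableT.
have E : nbd r [set: X] = setT by apply/seteqP; split => // x _; exact: sub_nbd.
by apply/eqP; rewrite eq_le -{2}E h1 -{2}E h2.
Qed.

Lemma finite_meas_fin_num al A : (al setT < +oo)%E -> measurable A ->
  al A \is a fin_num.
Proof.
move=> fa mA; rewrite ge0_fin_numE//; apply: le_lt_trans fa.
exact: meas_mono.
Qed.

(** A finite measurable partition is given by the function [idx] that sends a
point to the index of its cell. *)
Section Partition.
Context {n : nat} (idx : X -> 'I_n).
Context (midx : forall i, measurable (idx @^-1` [set i])).

Lemma fiberE (P : {pred 'I_n}) A : A `&` [set x | P (idx x)] =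
  \big[setU/set0]_(i < n | P i) (A `&` idx @^-1` [set i]).
Proof.
rewrite -bigcup_seq_cond; apply/seteqP; split => [x [Ax Px]|x].
  by exists (idx x) => //=; rewrite mem_index_enum.
by move=> [i /andP[_ Pi] [Ax /= xi]]; split => //=; rewrite xi.
Qed.

Lemma fiber_meas (P : {pred 'I_n}) : measurable [set x | P (idx x)].
Proof.
rewrite -(setTI [set x | P (idx x)]) fiberE.
by apply: bigsetU_measurable => i _; exact: measurableI.
Qed.

Lemma fiber_sum al (P : {pred 'I_n}) A : measurable A ->
  al (A `&` [set x | P (idx x)]) =
  (\sum_(i < n | P i) al (A `&` idx @^-1` [set i]))%E.
Proof.
move=> mA; rewrite fiberE; apply: measure_bigsetU_ord_cond.
  by move=> i _; exact: measurableI.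
by move=> i j _ _ [x [[_ <-] [_ <-]]].
Qed.

Lemma fiber_sumT al (P : {pred 'I_n}) :
  al [set x | P (idx x)] = (\sum_(i < n | P i) al (idx @^-1` [set i]))%E.
Proof.
rewrite -[X in al X]setTI fiber_sum//; apply: eq_bigr => i _; by rewrite setTI.
Qed.

(** The entry [m i j] is the mass sent from cell [i] to cell [j]. The last field
bounds the diameter of the union of two cells that exchange mass, because it is
such a diameter that enters the metric on measures. *)
Record plan r (m : 'I_n -> 'I_n -> R) al be : Prop := Plan {
  plan_ge0 : forall i j, 0 <= m i j ;
  plan_row : forall i, al (idx @^-1` [set i]) = (\sum_j m i j)%:E ;
  plan_col : forall j, be (idx @^-1` [set j]) = (\sum_i m i j)%:E ;
  plan_diam : forall i j, m i j != 0 -> forall x y,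
    idx x \in [:: i; j] -> idx y \in [:: i; j] -> mdist x y < r }.

Lemma plan_sym r m al be : plan r m al be -> plan r (fun i j => m j i) be al.
Proof.
by move=> [m0 m1 m2 m3]; split => // i j /m3 H x y xi yi;
  apply: H; move: xi yi; rewrite !inE ![_ || (_ == j)]orbC.
Qed.

(* The mass of [al] on [A] lies in the cells that meet [A]; they send it to cells
   inside the neighbourhood of [A]. *)
Let plan_half r m al be A : plan r m al be -> measurable A ->
  (al A <= be (nbd r A))%E.
Proof.
move=> [m0 m1 m2 m3] mA.
pose P : {pred 'I_n} := [pred i | `[< exists2 x, A x & idx x = i >]].
pose Q : {pred 'I_n} := [pred j | `[< idx @^-1` [set j] `<=` nbd r A >]].
apply: (@le_trans _ _ (al [set x | P (idx x)])).
  apply: meas_mono => //; first exact: fiber_meas.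
  by move=> x Ax; apply/asboolP; exists x.
apply: (@le_trans _ _ (be [set x | Q (idx x)])); last first.
  apply: meas_mono; [exact: fiber_meas|exact: nbd_meas|].
  by move=> x /asboolP; apply.
rewrite !fiber_sumT (eq_bigr _ (fun i _ => m1 i)) (eq_bigr _ (fun i _ => m2 i)).
rewrite !sumEFin lee_fin [leRHS]exchange_big/=.
rewrite [leRHS](bigID P)/= -[leLHS]addr0 lerD//; last first.
  by apply: sumr_ge0 => i _; apply: sumr_ge0.
apply: ler_sum => i /asboolP[x Ax xi].
rewrite (bigID Q)/= -[leRHS]addr0 lerD// le_eqVlt big1 ?eqxx// => j.
move=> /asboolP nQ; apply/eqP/negP => /negP mij; apply: nQ => y yj.
by exists x => //; apply: (m3 i j) => //; rewrite inE ?xi ?eqxx// yj !inE eqxx orbT.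
Qed.

Lemma plan_moves r m al be : plan r m al be -> moves r al be.
Proof.
by move=> p A mA; split; [exact: plan_half p mA|exact: plan_half (plan_sym p) mA].
Qed.

End Partition.

(** A point is put into the cell of the first ball of a finite cover of [K] that
contains it, and into the last cell if there is none. *)
Lemma compact_partition (K : set X) (dl : R) : compact K -> 0 < dl ->
  exists n (idx : X -> 'I_n.+1), [/\ forall i, measurable (idx @^-1` [set i]),
   forall x, K x -> idx x != ord_max &
   forall x y, idx x != ord_max -> idx x = idx y -> mdist x y < dl].
Proof.
move=> cK dl0.
have [s sK] : exists s : seq X, forall x, K x -> has (fun c => mdist c x < dl / 2) s.
  move: cK; rewrite compact_cover => /(_ X K (fun c => [set y | mdist c y < dl / 2])).
  case=> [c _|x Kx|s _ sK]; first exact: ball_open_metric.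
    by exists x => //=; rewrite mdistxx divr_gt0.
  exists (finmap.enum_fset s) => x /sK[c cs xc]; apply/hasP; exists c => //.
pose p x := fun c : X => mdist c x < dl / 2.
have ltp x : (find (p x) s < (size s).+1)%N by rewrite ltnS find_size.
exists (size s), (fun x => Ordinal (ltp x)); split.
- move=> [i lti].
  rewrite (_ : _ @^-1` _ = [set x | find (p x) s = i]); last first.
    by apply/seteqP; split => x /= [] // E; apply/val_inj.
  elim: s {sK ltp lti} i => [|c s IH] i /=.
    have [->|/eqP i0] := eqVneq i 0%N.
      by rewrite (_ : [set x | _] = setT)//; apply/seteqP; split.
    rewrite (_ : [set x | _] = set0)//; apply/seteqP; split => //= x /esym//.
  have mc : measurable [set x : X | p x c] by apply: open_borel; exact: ball_open_metric.
  case: i => [|i].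
    rewrite (_ : [set x | _] = [set x : X | p x c])//.
    by apply/seteqP; split => x /=; case: (p x c).
  rewrite (_ : [set x | _] = ~` [set x : X | p x c] `&` [set x | find (p x) s = i]).
    by apply: measurableI; [exact: measurableC|exact: IH].
  apply/seteqP; split => x /=; case: (p x c) => //=.
  - by move=> [<-]; split.
  - by case.
  - by move=> [_ ->].
- move=> x /sK; rewrite has_find => H.
  by apply/eqP => /(congr1 val)/= E; rewrite E ltnn in H.
- move=> x y xn /(congr1 val)/= E.
  have hx : has (p x) s.
    rewrite has_find ltn_neqAle find_size andbT.
    by apply: contra xn => /eqP xn; apply/eqP/val_inj.
  have hy : has (p y) s by rewrite has_find -E -has_find.
  have := nth_find x hx; have := nth_find x hy; rewrite -E /p => h1 h2.
  rewrite (le_lt_trans (metric_triangle _ (nth x s (find (p x) s)) _))//.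
  by rewrite metric_sym (splitr dl) ltrD.
Qed.

(** On the cells of a fine partition [moves] becomes Hall's condition for the
relation of containing points at a distance less than [r]. The last cell, which
need not be small, carries no mass. *)
Lemma moves_plan r (dl : R) al be (K : set X) : compact K ->
  (al setT < +oo)%E -> (be setT < +oo)%E -> al (~` K) = 0%E -> be (~` K) = 0%E ->
  0 < r -> 0 < dl -> moves r al be ->
  exists n (idx : X -> 'I_n.+1) m, (forall i, measurable (idx @^-1` [set i])) /\
    plan idx (r + dl) m al be.
Proof.
move=> cK fa fb aK bK r0 dl0 ab.
have dl2 : 0 < dl / 2 by rewrite divr_gt0.
have [n [idx [midx idxK idxd]]] := compact_partition cK dl2.
have null (g : meas) : g (~` K) = 0%E -> g (idx @^-1` [set ord_max]) = 0%E.
  move=> gK; apply/eqP; rewrite eq_le measure_ge0 andbT -gK; apply: meas_mono => //.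
    exact/measurableC/compact_borel.
  by move=> x /= xm Kx; move: (idxK x Kx); rewrite xm eqxx.
pose a i := fine (al (idx @^-1` [set i])); pose b i := fine (be (idx @^-1` [set i])).
have aE i : al (idx @^-1` [set i]) = (a i)%:E by rewrite fineK// finite_meas_fin_num.
have bE i : be (idx @^-1` [set i]) = (b i)%:E by rewrite fineK// finite_meas_fin_num.
pose e (i j : 'I_n.+1) := `[< exists x y, [/\ idx x = i, idx y = j & mdist x y < r] >].
have := @finite_transport R _ _ e a b.
case=> [i|j||S|m [m0 m1 m2 m3]].
- by rewrite fine_ge0.
- by rewrite fine_ge0.
- apply: EFin_inj; rewrite -!sumEFin.
  rewrite (eq_bigr _ (fun i _ => esym (aE i))) (eq_bigr _ (fun i _ => esym (bE i))).
  rewrite -(fiber_sumT midx al xpredT) -(fiber_sumT midx be xpredT).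
  rewrite (_ : [set x | _] = setT); last by apply/seteqP.
  exact: moves_mass ab.
- rewrite -lee_fin -!sumEFin.
  rewrite (eq_bigr _ (fun i _ => esym (aE i))) (eq_bigr _ (fun i _ => esym (bE i))).
  rewrite -(fiber_sumT midx al (mem S)) -(fiber_sumT midx be (mem (nbrs e S))).
  have [h _] := ab _ (fiber_meas midx (mem S)); apply: le_trans h _.
  apply: meas_mono; [exact: nbd_meas|exact: fiber_meas|].
  move=> y [x /= xS xy]; change (idx y \in nbrs e S).
  rewrite inE; apply/exists_inP; exists (idx x) => //.
  by apply/asboolP; exists x, y.
exists n, idx, m; split => //; split => //.
- by move=> i; rewrite m1.
- by move=> i; rewrite m2.
move=> i j mij.
have iN : i != ord_max.
  apply/eqP => iN; move: (m1 i); rewrite /a (_ : al _ = 0%E); [|by rewrite iN null] => /=;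
    move=> /psumr_eq0P.
  by move=> /(_ (fun j _ => m0 i j) j isT)/eqP; rewrite (negbTE mij).
have jN : j != ord_max.
  apply/eqP => jN; move: (m2 j); rewrite /b (_ : be _ = 0%E); [|by rewrite jN null] => /=;
    move=> /psumr_eq0P.
  by move=> /(_ (fun i _ => m0 i j) i isT)/eqP; rewrite (negbTE mij).
have /asboolP[x0 [y0 [x0i y0j xy]]] := m3 _ _ mij.
have same x y : idx x != ord_max -> idx x = idx y -> mdist x y < r + dl.
  move=> xN E; apply: lt_trans (idxd _ _ xN E) _.
  lra.
have cross x y : idx x = i -> idx y = j -> mdist x y < r + dl.
  move=> xi yj; rewrite (le_lt_trans (metric_triangle _ x0 _))//.
  rewrite (splitr dl) addrCA ltrD//; first by apply: idxd; rewrite xi ?x0i.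
  rewrite (le_lt_trans (metric_triangle _ y0 _))// ltrD//.
  by apply: idxd; rewrite ?y0j ?yj.
move=> x y; rewrite !inE => /orP[]/eqP xi /orP[]/eqP yj.
- by apply: same; rewrite xi.
- exact: cross.
- by rewrite metric_sym; exact: cross.
- by apply: same; rewrite xi.
Qed.

End Transport.

(** * Lipschitz curves of measures *)

Section LipschitzCurves.
Context {R : realType} {d : measure_display} {X : measurableMetricType d R}.
Local Notation meas := {measure set X -> \bar R}.
Implicit Types (al be nu : meas) (A B : set X) (r : R).
Context (mu : meas) (Xmu : metric_measure_space mu).
Let borel := mms_borel Xmu.

Lemma supp_closed al : closed (supp al).
Proof.
move=> x clx U oU Ux.
have [y [sy Uy]] := clx U (open_nbhs_nbhs (conj oU Ux)).
exact: sy.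
Qed.

Lemma supp_meas al : measurable (supp al).
Proof. exact: (closed_borel borel (@supp_closed _)). Qed.

(** Separability covers the complement of the support by countably many null balls. *)
Lemma supp_null al : al (~` supp al) = 0%E.
Proof.
have [D cD dD] := mms_separable Xmu.
have /pcard_surjP[g gD] := cD.
pose F k j := if al (ball (g k) j.+1%:R^-1) == 0%E then ball (g k) j.+1%:R^-1 else set0.
have mball (x : X) r : measurable (ball x r).
  by rewrite ballEmdist; apply: (open_borel borel); exact: ball_open_metric.
have nF k j : al.-negligible (F k j).
  rewrite /F; case: ifPn => [/eqP h|_]; last exact: negligible_set0.
  by exists (ball (g k) j.+1%:R^-1); split.
have nG : al.-negligible (\bigcup_k \bigcup_j F k j).
  by apply: negligible_bigcup => k; exact: negligible_bigcup.
apply: (measure_negligible (measurableC (@supp_meas _))).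
apply: negligibleS nG => x nx.
have [U [oU Ux U0]] : exists U, [/\ open U, U x & al U = 0%E].
  apply: contrapT => H; apply: nx => U oU Ux; rewrite lt0e measure_ge0 andbT.
  by apply/eqP => U0; apply: H; exists U.
have /nbhs_ballP[r /= r0 rU] : nbhs x U by exact: open_nbhs_nbhs.
have [j jr] : exists j : nat, j.+1%:R^-1 < r / 2 by apply: invSn_lt; rewrite divr_gt0.
have [q [/= xq Dq]] : [set y | mdist x y < j.+1%:R^-1] `&` D !=set0.
  apply: dD; last exact: ball_open_metric.
  by exists x => /=; rewrite mdistxx invr_gt0.
have [k _ kq] := gD _ Dq.
exists k => //; exists j => //; rewrite /F kq.
have -> : al (ball q j.+1%:R^-1) == 0%E.
  rewrite eq_le measure_ge0 andbT -U0; apply: meas_mono => //.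
    exact: (open_borel borel).
  move=> y qy; apply: rU; move: qy; rewrite !ballEmdist/= => qy.
  by rewrite (le_lt_trans (metric_triangle _ q _))// (splitr r) ltrD// (lt_trans _ jr).
by rewrite ballEmdist/= metric_sym.
Qed.

Lemma supp_le al be : (forall A, measurable A -> (al A <= be A)%E) ->
  supp al `<=` supp be.
Proof.
move=> ab x sx U oU Ux; apply: lt_le_trans (sx U oU Ux) _.
by apply: ab; exact: (open_borel borel).
Qed.

Lemma inM_le al be : (forall A, measurable A -> (al A <= be A)%E) ->
  inM mu be -> inM mu al.
Proof.
move=> ab [fb sb bm]; split.
- by apply: le_lt_trans fb; exact: ab.
- by apply: subclosed_compact sb _; [exact: supp_closed|exact: supp_le].
- by move=> A mA; apply: le_trans (ab _ mA) (bm _ mA).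
Qed.

Lemma null_supp (K : set X) al : closed K -> al (~` K) = 0%E -> supp al `<=` K.
Proof.
move=> cK aK x sx; apply: contrapT => nK.
by have := sx _ (closed_openC cK) nK; rewrite aK ltxx.
Qed.

Lemma null_off al A : measurable A -> supp al `<=` A -> al (~` A) = 0%E.
Proof.
move=> mA sA; apply/eqP; rewrite eq_le measure_ge0 andbT -(supp_null al).
by apply: meas_mono; [exact: measurableC|exact/measurableC/supp_meas|exact: subsetC].
Qed.

Lemma full_nbd al A : measurable A -> supp al `<=` A -> al A = al setT.
Proof.
move=> mA sA; apply/eqP; rewrite eq_le meas_mono//=.
rewrite -{1}(setUv A); apply: le_trans (meas_setU2 _ mA (measurableC mA)) _.
by rewrite null_off// adde0.
Qed.

(** What a term of the family puts on [A] is found near [A] in its partner, up to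
the difference of their masses: their supports lie within [e] of each other. *)
Lemma Gamma_moves (e dl r : R) al be I (a_ b_ : nat -> meas) A :
  Gamma mu e dl al be I a_ b_ -> e < r -> measurable A ->
  (al A <= be (nbd r A) + dl%:E)%E.
Proof.
move=> [inMab sumab dab diamab] er mA.
have mN := nbd_meas borel r A.
have [-> _] := sumab _ mA; have [_ ->] := sumab _ mN.
apply: (le_trans _ (leeD2l _ dab)).
rewrite -esumD => [|//|//]; apply: le_esum => i Ii.
have [[fa _ _] [fb _ _]] := inMab i Ii.
have [->|a0] := eqVneq (a_ i A) 0%E; first by rewrite adde_ge0.
have [x [Ax sx]] : exists x, A x /\ supp (a_ i) x.
  apply: contrapT => H; move/negP: a0; apply.
  rewrite eq_le measure_ge0 andbT -(supp_null (a_ i)); apply: meas_mono => //.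
    exact/measurableC/supp_meas.
  by move=> x Ax sx; apply: H; exists x.
rewrite (@full_nbd (b_ i))//; last first.
  move=> y sy; exists x => //; rewrite -lte_fin.
  apply: (@le_lt_trans _ _ e%:E); rewrite ?lte_fin//.
  apply: le_trans (diamab i Ii); apply: ereal_sup_ubound; right.
  by exists x; [left|exists y; [right|]].
apply: (@le_trans _ _ (a_ i setT)); first exact: meas_mono.
have fina : a_ i setT \is a fin_num by exact: finite_meas_fin_num.
have finb : b_ i setT \is a fin_num by exact: finite_meas_fin_num.
rewrite -(fineK fina) -(fineK finb) -EFinB abse_EFin -EFinD lee_fin.
by rewrite -lerBlDl ler_norm.
Qed.

Lemma Gamma_sym (e dl : R) al be I (a_ b_ : nat -> meas) :
  Gamma mu e dl al be I a_ b_ -> Gamma mu e dl be al I b_ a_.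
Proof.
move=> [h1 h2 h3 h4]; split.
- by move=> i /h1[].
- by move=> A /h2[].
- rewrite (eq_esum (b := fun i => `|a_ i setT - b_ i setT|%E))// => i /h1[[fa _ _] [fb _ _]].
  have fina : a_ i setT \is a fin_num by exact: finite_meas_fin_num.
  have finb : b_ i setT \is a fin_num by exact: finite_meas_fin_num.
  by rewrite -(fineK fina) -(fineK finb) -!EFinB !abse_EFin distrC.
- by move=> i /h4; rewrite setUC.
Qed.

Context (h : R -> R) (hh : gauge h).

Lemma dM_step (r : R) al be A : (dM mu h al be < r%:E)%E -> measurable A ->
  (al A <= be (nbd r A) + (h r)%:E)%E /\ (be A <= al (nbd r A) + (h r)%:E)%E.
Proof.
move=> /ereal_inf_lt[_ [e [e0 [I [a_ [b_ G]]]] <-]]; rewrite lte_fin => er mA.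
have hr : ((h e)%:E <= (h r)%:E)%E.
  by rewrite lee_fin ltW// (gauge_incr hh)// ltW.
split; (apply: le_trans (leeD2l _ hr)).
- exact: Gamma_moves G er mA.
- exact: Gamma_moves (Gamma_sym G) er mA.
Qed.

(** The loss allowed in [n.+1] equal steps of total length [r] is
[r * (h e / e)] with [e = r / n.+1], and this tends to [0]. *)
Lemma small_steps (r eps : R) : 0 < r -> 0 < eps ->
  exists n : nat, n.+1%:R * h (r / n.+1%:R) <= eps.
Proof.
move=> r0 e0.
have er : 0 < eps / r by rewrite divr_gt0.
have [q q0 qH] := at_right0_ex (cvgr_lt _ (gauge_deriv0 hh) _ er).
exists (Num.bound (r / q)).
set n := (Num.bound _).+1.
have n0 : 0 < n%:R :> R by rewrite ltr0n.
have rq : r / n%:R < q.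
  rewrite ltr_pdivrMr// mulrC -ltr_pdivrMr//.
  have rq0 : 0 <= r / q by rewrite ltW// divr_gt0.
  by apply: lt_trans (archi_boundP rq0) _; rewrite ltr_nat.
have rn0 : 0 < r / n%:R by rewrite divr_gt0.
have := qH (r / n%:R); rewrite rq rn0 => /(_ isT).
rewrite ltr_pdivrMr// => H.
have -> : eps = n%:R * (eps / r * (r / n%:R)) by field; rewrite !gt_eqF.
by rewrite ler_pM2l// ltW.
Qed.

(** Over many short steps the allowed losses of mass add up to an arbitrarily small
amount, so a Lipschitz curve transports its mass without any loss. *)
Lemma lip_curve_moves (b : R) (nu : R -> meas) (s t r : R) :
  lip_curve mu h b nu -> 0 <= s <= b -> 0 <= t <= b -> `|s - t| < r ->
  moves r (nu s) (nu t).
Proof.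
move=> [b0 inXn lipn] sb tb str.
suff H s' t' A : 0 <= s' <= b -> 0 <= t' <= b -> `|s' - t'| < r -> measurable A ->
    (nu s' A <= nu t' (nbd r A))%E.
  by move=> A mA; split; apply: H => //; rewrite distrC.
move=> {s t sb tb str} sb tb str mA.
set s := s' in sb str *; set t := t' in tb str *.
have r0 : 0 < r by exact: le_lt_trans str.
apply/lee_addgt0Pr => eps eps0.
have [n Hn] := small_steps r0 eps0.
pose u (i : nat) := s + (t - s) * (i%:R / n.+1%:R).
have n0 : 0 < n.+1%:R :> R by rewrite ltr0n.
have ub i : (i <= n.+1)%N -> 0 <= u i <= b.
  move=> iN; have i0 : 0 <= i%:R / n.+1%:R :> R by rewrite divr_ge0.
  have i1 : i%:R / n.+1%:R <= 1 :> R by rewrite ler_pdivrMr// mul1r ler_nat.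
  rewrite /u; move: i0 i1; set w := _ / _ => w0 w1.
  by move/andP: sb => [? ?]; move/andP: tb => [? ?]; apply/andP; split; nra.
have step i B : (i < n.+1)%N -> measurable B ->
    (nu (u i) B <= nu (u i.+1) (nbd (r / n.+1%:R) B) + (h (r / n.+1%:R))%:E)%E.
  move=> iN mB; have := @dM_step (r / n.+1%:R) (nu (u i)) (nu (u i.+1)) B.
  case=> //; apply: le_lt_trans (lipn _ _ (ub i (ltnW iN)) (ub i.+1 iN)) _.
  rewrite lte_fin (_ : u i - u i.+1 = (s - t) / n.+1%:R); last first.
    rewrite /u -natr1; field; by rewrite gt_eqF.
  by rewrite normrM (gtr0_norm (x := _^-1)) ?invr_gt0// ltr_pM2r ?invr_gt0.
have : (nu (u 0%N) A <= nu (u n.+1) (nbd (n.+1%:R * (r / n.+1%:R)) A) +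
    (n.+1%:R * h (r / n.+1%:R))%:E)%E.
  have : (n < n.+1)%N by [].
  elim: {1 3 4 6}n => [|i IH] iN.
    by rewrite !mul1r; exact: step.
  apply: le_trans (IH (ltnW iN)) _.
  have -> : i.+2%:R * h (r / n.+1%:R) = i.+1%:R * h (r / n.+1%:R) + h (r / n.+1%:R).
    by rewrite -(natr1 i.+1) mulrDl mul1r.
  rewrite EFinD addeA [leRHS]addeAC leeD2r//.
  apply: le_trans (step i.+1 _ iN (nbd_meas borel _ _)) _.
  rewrite leeD2r// meas_mono//; try exact: nbd_meas.
  by rewrite -(natr1 i.+1) mulrDl mul1r; exact: nbd_nbd.
have -> : u 0%N = s by rewrite /u mul0r mulr0 addr0.
have -> : u n.+1 = t by rewrite /u divff ?gt_eqF// mulr1 subrKC.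
rewrite mulrC divfK ?gt_eqF// => H; apply: le_trans H _.
by rewrite leeD2l// lee_fin.
Qed.

Lemma scaled_restr al (c : R) A : 0 <= c -> measurable A ->
  exists be : meas, forall B, be B = (c%:E * al (B `&` A))%E.
Proof.
move=> c0 mA.
by exists (mscale (NngNum c0) (mrestr al mA)) => B.
Qed.

Lemma esum_finType (T : finType) (f : T -> \bar R) : (forall t, (0 <= f t)%E) ->
  (\esum_(t in [set: T]) f t = \sum_t f t)%E.
Proof.
move=> f0; rewrite esum_fset//; last exact: finite_finset.
rewrite (_ : [set: T] = [set` enum T]).
  by rewrite -fsbig_seq ?enum_uniq// big_enum.
by apply/seteqP; split => // t _ /=; rewrite mem_enum.
Qed.

(** A plan on a fine partition yields an admissible family indexed by the pairs of
cells: the term for [(i, j)] consists of [al] on cell [i], scaled by the share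
of its mass that goes to [j], and of [be] on cell [j], scaled by the share that
comes from [i]. Both have the mass [m i j]. *)
Lemma moves_dM (rho : R) al be : inM mu al -> inM mu be -> 0 <= rho ->
  (forall r, rho < r -> moves r al be) -> (dM mu h al be <= rho%:E)%E.
Proof.
move=> Ma Mb rho0 H; apply/lee_addgt0Pr => e e0; rewrite -EFinD.
apply: ereal_inf_lbound; exists (rho + e) => //=; split; first lra.
have [fa sa _] := Ma; have [fb sb _] := Mb.
have cK := compactU sa sb; have := @moves_plan R d X borel (rho + e / 2) (e / 2) al be _ cK fa fb.
have e20 : 0 < e / 2 by rewrite divr_gt0.
have mU : measurable (supp al `|` supp be) by apply: measurableU; exact: supp_meas.
case=> [|||//||n [idx [m [midx p]]]].
- by apply: null_off; [exact: mU|left].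
- by apply: null_off; [exact: mU|right].
- lra.
- apply: H; lra.
have E : rho + e / 2 + e / 2 = rho + e by lra.
rewrite E in p.
pose N := ('I_n.+1 * 'I_n.+1)%type.
pose P i := idx @^-1` [set i].
pose a i := \sum_j m i j; pose b j := \sum_i m i j.
have m0 i j := plan_ge0 p i j.
have a0 i : 0 <= a i by exact: sumr_ge0.
have b0 j : 0 <= b j by exact: sumr_ge0.
have ma i j : m i j <= a i by rewrite /a (bigD1 j)//= lerDl sumr_ge0.
have mb i j : m i j <= b j by rewrite /b (bigD1 i)//= lerDl sumr_ge0.
have aE i : al (P i) = (a i)%:E := plan_row p i.
have bE j : be (P j) = (b j)%:E := plan_col p j.
have [aF aFE] := choice (fun q : N =>
  scaled_restr al (divr_ge0 (m0 q.1 q.2) (a0 q.1)) (midx q.1)).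
have [bF bFE] := choice (fun q : N =>
  scaled_restr be (divr_ge0 (m0 q.1 q.2) (b0 q.2)) (midx q.2)).
have ratio (x y : R) : 0 <= x -> x <= y -> 0 <= x / y <= 1.
  move=> x0 xy; rewrite divr_ge0 ?(le_trans x0)//=.
  have [->|y0] := eqVneq y 0; first by rewrite invr0 mulr0.
  have y1 : 0 < y by rewrite lt_neqAle eq_sym y0 (le_trans x0 xy).
  by rewrite ler_pdivrMr ?mul1r.
have scl (g : meas) (c : R) (i : 'I_n.+1) B : measurable B -> 0 <= c <= 1 ->
    (c%:E * g (B `&` P i) <= g B)%E.
  move=> mB /andP[c0 c1].
  apply: (@le_trans _ _ (g (B `&` P i))); last first.
    by apply: meas_mono => //; exact: (measurableI _ _ mB (midx i)).
  by rewrite -[leRHS]mul1e lee_wpmul2r.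
have aFle q B : measurable B -> (aF q B <= al B)%E.
  by move=> mB; rewrite aFE; apply: scl => //; exact: ratio.
have bFle q B : measurable B -> (bF q B <= be B)%E.
  by move=> mB; rewrite bFE; apply: scl => //; exact: ratio.
have aFT q : aF q setT = (m q.1 q.2)%:E.
  rewrite aFE setTI aE -EFinM; congr EFin.
  have [z|z] := eqVneq (a q.1) 0; last by rewrite divfK.
  by rewrite z mulr0; apply/eqP; rewrite eq_le m0/= -z ma.
have bFT q : bF q setT = (m q.1 q.2)%:E.
  rewrite bFE setTI bE -EFinM; congr EFin.
  have [z|z] := eqVneq (b q.2) 0; last by rewrite divfK.
  by rewrite z mulr0; apply/eqP; rewrite eq_le m0/= -z mb.
pose fam (F : N -> meas) (k : nat) : meas :=
  if unpickle k is Some q then F q else mzero.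
have famE F (q : N) : fam F (pickle q) = F q by rewrite /fam pickleK.
have resum (f : nat -> \bar R) : (forall k, (0 <= f k)%E) ->
    (\esum_(k in range (@pickle N)) f k = \sum_(q : N) f (pickle q))%E.
  move=> f0; rewrite (@reindex_esum _ N nat setT (range (@pickle N)) pickle).
    by rewrite (esum_finType (f := fun q : N => f (pickle q))).
  split; [by move=> x _; exists x| |by []].
  by move=> x y _ _; exact: (pcan_inj pickleK).
exists (range (@pickle N)), (fam aF), (fam bF); split.
- move=> k [q _ <-]; rewrite !famE; split.
  + by apply: (inM_le _ Ma) => B; exact: aFle.
  + by apply: (inM_le _ Mb) => B; exact: bFle.
- move=> A mA; rewrite !resum//.
  under eq_bigr do rewrite famE aFE.
  under [in X in _ /\ _ = X]eq_bigr do rewrite famE bFE.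
  have fib (g : meas) : g A = (\sum_i g (A `&` P i))%E.
    rewrite -(fiber_sum midx g xpredT mA); congr (g _).
    by apply/seteqP; split => x // -[].
  have small (g : meas) i c : g (P i) = c%:E -> c = 0 -> g (A `&` P i) = 0%E.
    move=> gc c0; apply/eqP; rewrite eq_le measure_ge0 andbT.
    have -> : 0%E = g (P i) by rewrite gc c0.
    by apply: meas_mono; [exact: (measurableI _ _ mA (midx i))|exact: midx|].
  split.
    rewrite fib -(pair_bigA _ (fun i j => (m i j / a i)%:E * al (A `&` P i))%E)/=.
    apply: eq_bigr => i _; rewrite -ge0_sume_distrl; last first.
      by move=> j _; rewrite lee_fin divr_ge0.
    rewrite sumEFin -mulr_suml -/(a i).
    have [z|z] := eqVneq (a i) 0; last by rewrite divff// mul1e.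
    by rewrite (small al i (a i))// mule0.
  rewrite fib -(pair_bigA _ (fun i j => (m i j / b j)%:E * be (A `&` P j))%E)/=.
  rewrite exchange_big/=; apply: eq_bigr => j _; rewrite -ge0_sume_distrl; last first.
    by move=> i _; rewrite lee_fin divr_ge0.
  rewrite sumEFin -mulr_suml -/(b j).
  have [z|z] := eqVneq (b j) 0; last by rewrite divff// mul1e.
  by rewrite (small be j (b j))// mule0.
- rewrite resum// big1 ?lee_fin ?(gauge_ge0 hh)//; first lra.
  by move=> q _; rewrite !famE aFT bFT subee// abse0.
- move=> k [[i j] _ <-]; rewrite !famE; apply: ge_ereal_sup => v [->|].
    by rewrite lee_fin; lra.
  move=> [x sx [y sy <-]]; rewrite lee_fin.
  (* a point of either support is a limit of points of the cells [i] and [j] *)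
  have close z kap : (supp (aF (i, j)) `|` supp (bF (i, j))) z -> 0 < kap ->
      m i j != 0 /\ exists z', idx z' \in [:: i; j] /\ mdist z z' < kap.
    have mz (g : meas) c l B : g B = (c%:E * be (B `&` P l))%E \/
       g B = (c%:E * al (B `&` P l))%E -> (0 < g B)%E -> c != 0 /\ B `&` P l !=set0.
      move=> gE g0; split.
        by apply: contraTneq g0 => c0; case: gE => ->; rewrite c0 mul0e ltxx.
      apply/set0P; apply: contraTneq g0 => B0.
      by case: gE => ->; rewrite B0 measure0 mule0 ltxx.
    move=> + k0; have oB := ball_open_metric z kap.
    have Bz : [set z' : X | mdist z z' < kap] z by rewrite /= mdistxx.
    move=> [/(_ _ oB Bz)|/(_ _ oB Bz)] S.
      have [|c0 [z' [/= zz Pz]]] := mz _ (m i j / a i) i _ _ S.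
        by right; rewrite aFE.
      split; first by apply: contraNneq c0 => ->; rewrite mul0r.
      by exists z'; rewrite inE Pz eqxx.
    have [|c0 [z' [/= zz Pz]]] := mz _ (m i j / b j) j _ _ S.
      by left; rewrite bFE.
    split; first by apply: contraNneq c0 => ->; rewrite mul0r.
    by exists z'; rewrite !inE Pz eqxx orbT.
  apply/ler_addgt0Pr => kap kap0.
  have k20 : 0 < kap / 2 by rewrite divr_gt0.
  have [mij [x' [x'i xx']]] := close _ _ sx k20.
  have [_ [y' [y'i yy']]] := close _ _ sy k20.
  have := plan_diam p mij x'i y'i.
  have := metric_triangle x x' y; have := metric_triangle x' y' y.
  have := metric_sym y y'; lra.
Qed.

End LipschitzCurves.

(** * Splitting a curve at finitely many times *)

Section Splitting.
Context {R : realType} {d : measure_display} {X : measurableMetricType d R}.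
Local Notation meas := {measure set X -> \bar R}.
Implicit Types (al be nu : meas) (A B : set X) (r : R).
Context (mu : meas) (Xmu : metric_measure_space mu).
Let borel := mms_borel Xmu.

Definition addm al be nu := forall A, measurable A -> nu A = (al A + be A)%E.

(** Unit speed in terms of transport: the mass travels over a distance of at most
[`|t - t'|] between the times [t] and [t']. *)
Definition moving_curve (s : R) (nu : R -> meas) := forall t t' r, 0 <= t <= s ->
  0 <= t' <= s -> `|t - t'| < r -> moves r (nu t) (nu t').

Lemma addm_lel al be nu A : addm al be nu -> measurable A -> (al A <= nu A)%E.
Proof. by move=> E mA; rewrite E// leeDl. Qed.

Lemma addm_ler al be nu A : addm al be nu -> measurable A -> (be A <= nu A)%E.
Proof. by move=> E mA; rewrite E// leeDr. Qed.

Lemma weighted_restr n (idx : X -> 'I_n.+1) (w : 'I_n.+1 -> R) nu :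
  (forall i, measurable (idx @^-1` [set i])) -> (forall i, 0 <= w i) ->
  exists be : meas, forall B,
    be B = (\sum_j (w j)%:E * nu (B `&` idx @^-1` [set j]))%E.
Proof.
move=> midx w0.
have [F FE] := choice (fun j => scaled_restr nu (w0 j) (midx j)).
exists (msum (fun k => F (inord k)) n.+1) => B.
rewrite /= /msum; apply: eq_bigr => j _; by rewrite inord_val FE.
Qed.

(** Each cell of a plan from [nu] to [nu'] sends off its mass with the part of [al]
in it spread proportionally over all targets, and each target cell receives a
multiple of the restriction of [nu']. Doing the same for [be] uses the
complementary proportions, so the two images add up to [nu']. *)
Lemma split_step al be nu nu' r r' : inM mu nu -> inM mu nu' -> 0 < r -> r < r' ->
  moves r nu nu' -> addm al be nu ->
  exists al' be', [/\ addm al' be' nu', moves r' al al' & moves r' be be'].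
Proof.
move=> Mn Mn' r0 rr nn ab.
have [fn sn _] := Mn; have [fn' sn' _] := Mn'.
have cK := compactU sn sn'.
have mU : measurable (supp nu `|` supp nu').
  by apply: measurableU; exact: (supp_meas Xmu).
have [|||||n [idx [m [midx p]]]] := @moves_plan R d X borel r (r' - r) nu nu' _ cK fn fn'.
- by apply: (null_off Xmu); [exact: mU|left].
- by apply: (null_off Xmu); [exact: mU|right].
- by [].
- by rewrite subr_gt0.
- by [].
rewrite subrKC in p.
pose P i := idx @^-1` [set i].
pose b j := \sum_i m i j; pose a i := \sum_j m i j.
have m0 i j := plan_ge0 p i j.
have a0 i : 0 <= a i by exact: sumr_ge0.
have b0 j : 0 <= b j by exact: sumr_ge0.
have aE i : nu (P i) = (a i)%:E := plan_row p i.
have bE j : nu' (P j) = (b j)%:E := plan_col p j.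
(* [w] is the share of [g] in the mass of a source cell, [w'] the resulting share
   in a target cell; an empty cell has share 0, by division by zero. *)
pose w (g : meas) i := fine (g (P i)) / a i.
have w0 g i : 0 <= w g i by rewrite divr_ge0// fine_ge0.
pose w' (g : meas) j := (\sum_i w g i * m i j) / b j.
have w'0 g j : 0 <= w' g j by rewrite divr_ge0// sumr_ge0// => i _; rewrite mulr_ge0.
have push (g : meas) : (forall A, measurable A -> (g A <= nu A)%E) ->
  exists g' : meas, (forall B, g' B = (\sum_j (w' g j)%:E * nu' (B `&` P j))%E) /\
    moves r' g g'.
  move=> gn; have [g' g'E] := weighted_restr nu' midx (w'0 g).
  exists g'; split => //.
  have gP i : g (P i) = (w g i * a i)%:E.
    have gf : g (P i) \is a fin_num.
      by apply: finite_meas_fin_num (midx i); apply: le_lt_trans fn; exact: gn.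
    rewrite -(fineK gf) /w; congr EFin.
    have [z|z] := eqVneq (a i) 0; last by rewrite divfK.
    rewrite z mulr0; apply/eqP; rewrite eq_le fine_ge0// andbT -z -lee_fin fineK//.
    by rewrite -aE; apply: gn; exact: midx.
  have w1 i : w g i <= 1 \/ a i = 0.
    have [z|z] := eqVneq (a i) 0; [by right|left].
    have a1 : 0 < a i by rewrite lt_neqAle eq_sym z a0.
    by rewrite -(ler_pM2r a1) mul1r -lee_fin -gP -aE; apply: gn; exact: midx.
  have wm i j : w g i * m i j <= m i j.
    case: (w1 i) => [w1i|z]; first by rewrite ler_piMl.
    suff -> : m i j = 0 by rewrite mulr0.
    by move/eqP: z; rewrite psumr_eq0// => /allP/(_ j (mem_index_enum j))/eqP.
  apply: (plan_moves borel midx (m := fun i j => w g i * m i j)); split.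
  - by move=> i j; rewrite mulr_ge0.
  - by move=> i; rewrite gP mulr_sumr.
  - move=> j; rewrite g'E (bigD1 j)//= big1 ?adde0 => [|i ij]; last first.
      rewrite (_ : _ `&` _ = set0) ?measure0 ?mule0//.
      apply/seteqP; split => // x [/= xj xi].
      by move: ij; rewrite -xj -xi eqxx.
    rewrite setIid bE -EFinM /w'; congr EFin.
    have [z|z] := eqVneq (b j) 0; last by rewrite divfK.
    rewrite z mulr0; apply/esym/eqP; rewrite eq_le sumr_ge0 ?andbT; last first.
      by move=> i _; rewrite mulr_ge0.
    by apply: (@le_trans _ _ (b j)); [apply: ler_sum|rewrite z].
  - move=> i j wmij; apply: (plan_diam p); apply: contraNneq wmij => ->.
    by rewrite mulr0.
have [al' [al'E ma]] := push al (fun A mA => addm_lel ab mA).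
have [be' [be'E mb]] := push be (fun A mA => addm_ler ab mA).
exists al', be'; split => // A mA.
have -> : nu' A = (\sum_j nu' (A `&` P j))%E.
  rewrite -(fiber_sum midx nu' xpredT mA); congr (nu' _).
  by apply/seteqP; split => x // -[].
rewrite al'E be'E -big_split/=; apply: eq_bigr => j _.
rewrite -ge0_muleDl ?lee_fin// -EFinD /w' -mulrDl -big_split/=.
have [z|z] := eqVneq (b j) 0.
  have -> : nu' (A `&` P j) = 0%E; last by rewrite mule0.
  apply/eqP; rewrite eq_le measure_ge0 andbT.
  have -> : 0%E = nu' (P j) by rewrite bE z.
  by apply: meas_mono; [exact: (measurableI _ _ mA (midx j))|exact: midx|].
rewrite (_ : \sum_i _ = b j) ?divff ?mul1e//.
apply: eq_bigr => i _; rewrite -mulrDl.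
have [z'|z'] := eqVneq (a i) 0.
  suff -> : m i j = 0 by rewrite mulr0.
  by move/eqP: z'; rewrite psumr_eq0// => /allP/(_ j (mem_index_enum j))/eqP.
rewrite -mulrDl -fineD.
- by rewrite -ab ?aE ?divff ?mul1r//; exact: midx.
- by apply: finite_meas_fin_num (midx i); apply: le_lt_trans fn; exact: (addm_lel ab).
- by apply: finite_meas_fin_num (midx i); apply: le_lt_trans fn; exact: (addm_ler ab).
Qed.

(** The two parts are moved from one time to the next by [split_step], which widens
the distance a little. The first step uses up half of the excess [kap] and leaves
the other half to the later ones. *)
Lemma split_chain (s : R) (nu : R -> meas) : moving_curve s nu ->
  (forall t, 0 <= t <= s -> inM mu (nu t)) ->
  forall (l : seq R) t0 kap al be, 0 < kap -> path <%R t0 l ->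
  {in t0 :: l, forall t, 0 <= t <= s} -> addm al be (nu t0) ->
  exists A B : R -> meas, [/\ A t0 = al, B t0 = be,
    {in t0 :: l, forall t, addm (A t) (B t) (nu t)} &
    {in t0 :: l &, forall t t', t <= t' -> moves (t' - t + kap) (A t) (A t') /\
                                          moves (t' - t + kap) (B t) (B t')}].
Proof.
move=> hn Mn; elim=> [|t1 l IH] t0 kap al be k0.
  move=> _ _ ab; exists (fun=> al), (fun=> be); split => //.
    by move=> t; rewrite inE => /eqP ->.
  by move=> t t' _ _ tt; split; apply: (moves_refl borel); rewrite ltr_wpDl// subr_ge0.
move=> /= /andP[t01 pl] ts ab.
have t0s : 0 <= t0 <= s by apply: ts; rewrite mem_head.
have t1s : 0 <= t1 <= s by apply: ts; rewrite !inE eqxx orbT.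
have k2 : 0 < kap / 2 by rewrite divr_gt0.
have [|||al1 [be1 [ab1 ma mb]]] := @split_step al be (nu t0) (nu t1)
  (t1 - t0 + kap / 4) (t1 - t0 + kap / 2) (Mn _ t0s) (Mn _ t1s) _ _ _ ab.
- lra.
- lra.
- by apply: hn => //; rewrite distrC gtr0_norm ?subr_gt0//; lra.
have [|A [B [A1 B1 AB1 mAB1]]] := IH t1 (kap / 2) al1 be1 k2 pl _ ab1.
  by move=> t tl; apply: ts; rewrite inE tl orbT.
have gt0 t : t \in t1 :: l -> t0 < t.
  rewrite inE => /orP[/eqP->//|tl]; apply: (lt_trans t01).
  by have /allP := order_path_min (@lt_trans _ R) pl; apply.
have ne t : t \in t1 :: l -> t == t0 = false by move/gt0/gt_eqF.
exists (fun t => if t == t0 then al else A t), (fun t => if t == t0 then be else B t).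
rewrite eqxx; split => //.
  move=> t; rewrite inE => /orP[/eqP->|tl]; first by rewrite eqxx.
  by rewrite ne//; exact: AB1.
move=> t t'; rewrite inE => /orP[/eqP->|tl]; rewrite inE => /orP[/eqP->|tl'] tt.
- by rewrite eqxx; split; apply: (moves_refl borel); rewrite subrr add0r.
- rewrite eqxx ne//.
  have t1t' : t1 <= t'.
    move: tl'; rewrite inE => /orP[/eqP->//|tl'].
    by have /allP/(_ _ tl')/ltW := order_path_min (@lt_trans _ R) pl.
  have [mA mB] := mAB1 t1 t' (mem_head _ _) tl' t1t'.
  have E : t1 - t0 + kap / 2 + (t' - t1 + kap / 2) = t' - t0 + kap by lra.
  rewrite -E; rewrite A1 in mA; rewrite B1 in mB; split.
    exact: (moves_trans borel ma mA).
  exact: (moves_trans borel mb mB).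
- by have := gt0 _ tl; rewrite ltNge tt.
- rewrite !ne//; have [mA mB] := mAB1 t t' tl tl' tt.
  by split; [apply: (moves_le borel _ mA)|apply: (moves_le borel _ mB)]; lra.
Qed.

End Splitting.

(** * Setwise limits of measures *)

Section Ultralimit.
Context {R : realType} {T : Type} {U : set_system T} {UU : UltraFilter U}.

(** A cluster point in the compact interval is a limit, since an ultrafilter decides
every neighbourhood. *)
Lemma ultra_bounded_cvg (u : T -> R) (M : R) : (forall i, 0 <= u i <= M) ->
  exists2 l : R, 0 <= l & u @ U --> l.
Proof.
move=> uM.
have FM : U (u @^-1` `[0, M]%classic).
  by apply: filterE => i /=; rewrite in_itv/= uM.
have [l [/= lM cl]] := @segment_compact R 0 M (u @ U) _ FM.
exists l; first by move: lM; rewrite in_itv/= => /andP[].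
move=> V Vl.
have [//|UV] := in_ultra_setVsetC (u @^-1` V) UU.
by have [x [nV Vx]] := cl (~` V) V UV Vl; case: nV.
Qed.

Lemma le_lim_filter (u v : T -> R) (x y : R) : u @ U --> x -> v @ U --> y ->
  U [set i | u i <= v i] -> x <= y.
Proof.
move=> ux vy uv; rewrite leNgt; apply/negP => yx.
have e0 : 0 < (x - y) / 2 by rewrite divr_gt0// subr_gt0.
have /cvgrPdist_lt/(_ _ e0) h1 := ux; have /cvgrPdist_lt/(_ _ e0) h2 := vy.
have [i [[/= i1 i2] i3]] := filter_ex (filterI (filterI h1 h2) uv).
move: i1 i2 i3; rewrite !ltr_norml => /andP[a1 a2] /andP[b1 b2] /= c; lra.
Qed.

End Ultralimit.

Section SetwiseLimit.
Context {R : realType} {d : measure_display} {X : measurableType d}.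
Local Notation meas := {measure set X -> \bar R}.
Context {T : Type} {U : set_system T} {UU : UltraFilter U}.

(** Along an ultrafilter the values on every set converge, and the limit is
additive. It stays below the finite measure [nu], which turns finite additivity
into countable additivity: the missing part of a union has small [nu]-measure. *)
Lemma setwise_limit (m : T -> meas) (nu : meas) : (nu setT < +oo)%E ->
  (forall i A, measurable A -> (m i A <= nu A)%E) ->
  exists ga : meas, forall A, measurable A ->
    (ga A <= nu A)%E /\ (fun i => fine (m i A)) @ U --> fine (ga A).
Proof.
move=> fnu mnu.
have leN A B (g : meas) : measurable A -> measurable B -> A `<=` B -> (g A <= g B)%E.
  by move=> mA mB AB; apply: le_measure => //; rewrite inE.
have nfin A : measurable A -> nu A \is a fin_num.
  by move=> mA; rewrite ge0_fin_numE//; apply: le_lt_trans fnu; exact: leN.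
have mfin i A : measurable A -> m i A \is a fin_num.
  move=> mA; rewrite ge0_fin_numE//; apply: (le_lt_trans (mnu i A mA)).
  by rewrite -ge0_fin_numE ?nfin.
have ex A : exists l : R, 0 <= l /\ (measurable A -> (fun i => fine (m i A)) @ U --> l).
  have [mA|nA] := pselect (measurable A); last by exists 0; split.
  have [|l l0 ul] := @ultra_bounded_cvg R T U UU (fun i => fine (m i A)) (fine (nu A)).
    by move=> i; rewrite fine_ge0//= fine_le ?mfin ?nfin ?mnu.
  by exists l; split.
have [f fP] := choice ex.
have f0 A : 0 <= f A := (fP A).1.
have fcvg A (mA : measurable A) := (fP A).2 mA.
have fle A : measurable A -> f A <= fine (nu A).
  move=> mA; apply: (le_lim_filter (fcvg _ mA) (cvg_cst (fine (nu A)))).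
  by apply: filterE => i /=; rewrite fine_le ?mfin ?nfin ?mnu.
have cvgu (u : T -> R) (x y : R) : u @ U --> x -> u @ U --> y -> x = y.
  by move=> ux uy; apply/eqP; rewrite eq_le; apply/andP; split;
    [apply: (le_lim_filter ux uy)|apply: (le_lim_filter uy ux)]; apply: filterE => i /=.
have fempty : f set0 = 0.
  apply: (cvgu (fun i => fine (m i set0))); first exact: fcvg.
  by under eq_fun do rewrite measure0/=; exact: cvg_cst.
have fadd A B : measurable A -> measurable B -> A `&` B = set0 -> f (A `|` B) = f A + f B.
  move=> mA mB AB; apply: (cvgu (fun i => fine (m i (A `|` B)))).
    exact/fcvg/measurableU.
  under eq_fun do rewrite measureU// fineD ?mfin//.
  by apply: cvgD; exact: fcvg.
pose ga A := (f A)%:E.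
have ga0 : ga set0 = 0%E by rewrite /ga fempty.
have gage A : (0 <= ga A)%E by rewrite lee_fin.
have gasig : semi_sigma_additive ga.
  move=> F mF tF mUF.
  have mFn n : measurable (\big[setU/set0]_(i < n) F i).
    by apply: bigsetU_measurable => i _; exact: mF.
  have finsum n : f (\big[setU/set0]_(i < n) F i) = \sum_(i < n) f (F i).
    elim: n => [|n IH]; first by rewrite !big_ord0.
    rewrite !big_ord_recr/= fadd; [by rewrite IH|exact: mFn|exact: mF|].
    apply/seteqP; split => // x [].
    rewrite -bigcup_mkord => -[i /= ilt Fix] Fnx.
    have E : i = n by apply: tF => //; exists x.
    by move: ilt; rewrite E ltnn.
  have nsum := @measure_semi_sigma_additive _ _ _ nu F mF tF mUF.
  have nfsum n : (\sum_(0 <= i < n) nu (F i))%E = (\sum_(i < n) fine (nu (F i)))%:E.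
    by rewrite big_mkord -sumEFin; apply: eq_bigr => i _; rewrite fineK ?nfin.
  have nnu n : nu (\big[setU/set0]_(i < n) F i) = (\sum_(i < n) fine (nu (F i)))%:E.
    by rewrite -nfsum big_mkord; exact: measure_bigsetU.
  apply: cvg_EFin.
    apply: nearW => n; rewrite big_mkord /ga sumEFin//.
  have -> : fine \o (fun n => \sum_(0 <= i < n) ga (F i))%E = fun n => \sum_(i < n) f (F i).
    by apply/funext => n /=; rewrite big_mkord /ga sumEFin.
  apply: (@squeeze_cvgr _ _ _ _
    (fun n => f (\bigcup_n F n) - (fine (nu (\bigcup_n F n)) - \sum_(i < n) fine (nu (F i))))
    (fun=> f (\bigcup_n F n))); last exact: cvg_cst.
    apply: nearW => n.
    pose D := (\bigcup_n F n) `\` (\big[setU/set0]_(i < n) F i).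
    have mD : measurable D by exact: measurableD.
    have sub : \big[setU/set0]_(i < n) F i `<=` \bigcup_n F n.
      by rewrite -bigcup_mkord => x [i _ Fx]; exists i.
    have UD : \bigcup_n F n = \big[setU/set0]_(i < n) F i `|` D.
      by rewrite /D setDUK.
    have disj : \big[setU/set0]_(i < n) F i `&` D = set0.
      by apply/seteqP; split => // x [xA [_]]; exact.
    have fU : f (\bigcup_n F n) = \sum_(i < n) f (F i) + f D.
      by rewrite {1}UD fadd// finsum.
    have nU : fine (nu (\bigcup_n F n)) = \sum_(i < n) fine (nu (F i)) + fine (nu D).
      have -> : nu (\bigcup_n F n) = (nu (\big[setU/set0]_(i < n) F i) + nu D)%E.
        by rewrite {1}UD; exact: measureU.
      by rewrite fineD ?nfin// nnu.
    by rewrite /= fU nU; have := f0 D; have := fle _ mD; lra.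
  rewrite -[X in _ --> X]subr0; apply: cvgB; first exact: cvg_cst.
  rewrite -[X in _ --> X](subrr (fine (nu (\bigcup_n F n)))); apply: cvgB; first exact: cvg_cst.
  have -> : (fun n => \sum_(i < n) fine (nu (F i))) =
      fine \o (fun n => \sum_(0 <= i < n) nu (F i))%E.
    by apply/funext => n /=; rewrite nfsum.
  by apply: fine_cvg; rewrite fineK ?nfin.
pose mix := isMeasure.Build d X R ga ga0 gage gasig.
pose gam : meas := HB.pack ga mix.
exists gam => A mA; split; last exact: fcvg.
by rewrite -(fineK (nfin _ mA)) lee_fin; exact: fle.
Qed.

End SetwiseLimit.

(** * Splitting a whole curve *)

Section SplitCurve.
Context {R : realType} {d : measure_display} {X : measurableMetricType d R}.
Local Notation meas := {measure set X -> \bar R}.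
Implicit Types (al be nu : meas) (A B : set X) (r : R).
Context (mu : meas) (Xmu : metric_measure_space mu).
Let borel := mms_borel Xmu.

(** A compactness argument. The index [(l, n)] stands for a splitting at the times
in the finite list [l] with the excess [1 / n.+1], as given by [split_chain]. An
ultrafilter that eventually puts every time into [l] and makes the excess small
has setwise limits at all times, and these limits inherit the transport
inequalities, which compare values on single sets. *)
Lemma moving_curve_split (s : R) (nu : R -> meas) al be : 0 <= s -> moving_curve s nu ->
  (forall t, 0 <= t <= s -> inM mu (nu t)) -> addm al be (nu 0) ->
  exists A B : R -> meas, [/\ moving_curve s A, moving_curve s B,
    forall t, 0 <= t <= s -> addm (A t) (B t) (nu t), eqm (A 0) al & eqm (B 0) be].
Proof.
move=> s0 hn Mn ab.
pose T := (seq R * nat)%type.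
pose grid (i : T) := sort <=%R (undup [seq t <- i.1 | 0 < t <= s]).
pose kap (i : T) : R := i.2.+1%:R^-1.
have kap0 i : 0 < kap i by rewrite invr_gt0 ltr0n.
have gridE i t : (t \in grid i) = (0 < t <= s) && (t \in i.1).
  by rewrite mem_sort mem_undup mem_filter.
have gridp i : path <%R 0 (grid i).
  rewrite path_min_sorted; first by rewrite sort_lt_sorted undup_uniq.
  by apply/allP => t; rewrite gridE => /andP[/andP[]].
have gridin i : {in 0 :: grid i, forall t, 0 <= t <= s}.
  move=> t; rewrite inE => /orP[/eqP->|]; first by rewrite lexx.
  by rewrite gridE => /andP[/andP[/ltW-> ->]].
have ex i : exists AB : (R -> meas) * (R -> meas), [/\ AB.1 0 = al, AB.2 0 = be,
    {in 0 :: grid i, forall t, addm (AB.1 t) (AB.2 t) (nu t)} &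
    {in 0 :: grid i &, forall t t', t <= t' ->
        moves (t' - t + kap i) (AB.1 t) (AB.1 t') /\
        moves (t' - t + kap i) (AB.2 t) (AB.2 t')}].
  have [A [B H]] := split_chain Xmu hn Mn (kap0 i) (gridp i) (gridin i) ab.
  by exists (A, B).
have [AB ABP] := choice ex.
pose on (i : T) t := t \in 0 :: i.1.
have onE i t : 0 <= t <= s -> on i t -> t \in 0 :: grid i.
  rewrite /on !inE gridE => /andP[t0 ts] /orP[->//|ti]; rewrite ti ts andbT andbT.
  by case: (eqVneq t 0) => //= tn; rewrite lt_neqAle eq_sym tn t0.
(* at times off the grid, 0 is a value that keeps the family below [nu t] *)
pose mA t i : meas := if on i t then (AB i).1 t else mzero.
pose mB t i : meas := if on i t then (AB i).2 t else mzero.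
have on0 i : on i 0 by rewrite /on mem_head.
pose base (i : T) : set T := [set j : T | {subset i.1 <= j.1} /\ (i.2 <= j.2)%N].
have Fbase : ProperFilter (filter_from [set: T] base).
  apply: filter_from_proper; last by move=> i _; exists i; split.
  apply: filter_fromT_filter; first by exists ([::], 0%N).
  move=> i j; exists (i.1 ++ j.1, maxn i.2 j.2) => k [/= lk nk].
  split; split => /=.
  - by move=> t ti; apply: lk; rewrite mem_cat ti.
  - exact: leq_trans (leq_maxl _ _) nk.
  - by move=> t tj; apply: lk; rewrite mem_cat tj orbT.
  - exact: leq_trans (leq_maxr _ _) nk.
have [U [UU FU]] := ultraFilterLemma Fbase.
have Uon t : U [set i | on i t].
  apply: FU; exists ([:: t], 0%N) => // j [/= lj _].
  by rewrite /on inE lj ?orbT// mem_head.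
have Ukap (e : R) : 0 < e -> U [set i | kap i < e].
  move=> e0; apply: FU; exists ([::], Num.bound e^-1) => // j [/= _ nj].
  rewrite /kap invf_plt ?posrE//.
  have e1 : 0 <= e^-1 by rewrite invr_ge0 ltW.
  by apply: lt_le_trans (archi_boundP e1) _; rewrite ler_nat ltnW// ltnS.
have mAle t i A : 0 <= t <= s -> measurable A -> (mA t i A <= nu t A)%E.
  move=> ts mA'; rewrite /mA; case: ifP => [oi|_]; last exact: measure_ge0.
  have [_ _ H _] := ABP i.
  by apply: (addm_lel _ mA'); apply: H; exact: onE.
have mBle t i A : 0 <= t <= s -> measurable A -> (mB t i A <= nu t A)%E.
  move=> ts mA'; rewrite /mB; case: ifP => [oi|_]; last exact: measure_ge0.
  have [_ _ H _] := ABP i.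
  by apply: (addm_ler _ mA'); apply: H; exact: onE.
have exA t : exists ga : meas, 0 <= t <= s -> forall A, measurable A ->
    (ga A <= nu t A)%E /\ (fun i => fine (mA t i A)) @ U --> fine (ga A).
  have [ts|nts] := pselect (0 <= t <= s); last by exists (mzero : meas).
  have [fn _ _] := Mn t ts.
  have [ga H] := setwise_limit fn (fun i A => mAle t i A ts).
  by exists ga.
have exB t : exists ga : meas, 0 <= t <= s -> forall A, measurable A ->
    (ga A <= nu t A)%E /\ (fun i => fine (mB t i A)) @ U --> fine (ga A).
  have [ts|nts] := pselect (0 <= t <= s); last by exists (mzero : meas).
  have [fn _ _] := Mn t ts.
  have [ga H] := setwise_limit fn (fun i A => mBle t i A ts).
  by exists ga.
have [A AP] := choice exA; have [B BP] := choice exB.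
have nfin t A' : 0 <= t <= s -> measurable A' -> nu t A' \is a fin_num.
  by move=> ts; have [fn _ _] := Mn t ts; exact: finite_meas_fin_num.
have fin_le (g : meas) t A' : 0 <= t <= s -> measurable A' -> (g A' <= nu t A')%E ->
    g A' \is a fin_num.
  move=> ts mA' gn; rewrite ge0_fin_numE//; apply: le_lt_trans gn _.
  by rewrite -ge0_fin_numE// nfin.
have s00 : 0 <= (0 : R) <= s by apply/andP.
have cvgu (u : T -> R) (x y : R) : u @ U --> x -> u @ U --> y -> x = y.
  by move=> ux uy; apply/eqP; rewrite eq_le; apply/andP; split;
    [apply: (le_lim_filter ux uy)|apply: (le_lim_filter uy ux)]; apply: filterE => i /=.
have limmoves (C : R -> meas) (m : R -> T -> meas) :
   (forall t, 0 <= t <= s -> forall A, measurable A ->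
    (C t A <= nu t A)%E /\ (fun i => fine (m t i A)) @ U --> fine (C t A)) ->
   (forall t i A, 0 <= t <= s -> measurable A -> (m t i A <= nu t A)%E) ->
   (forall t t' i, 0 <= t <= s -> 0 <= t' <= s -> on i t -> on i t' -> t <= t' ->
     moves (t' - t + kap i) (m t i) (m t' i)) -> moving_curve s C.
  move=> CP mle mm.
  have half t t' r A' : 0 <= t <= s -> 0 <= t' <= s -> `|t - t'| < r -> measurable A' ->
      (C t A' <= C t' (nbd r A'))%E.
    move=> ts ts' tr mA'; have mN := nbd_meas borel r A'.
    have [h1 h2] := CP t ts _ mA'; have [h3 h4] := CP t' ts' _ mN.
    rewrite -(fineK (fin_le _ _ _ ts mA' h1)) -(fineK (fin_le _ _ _ ts' mN h3)) lee_fin.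
    apply: (le_lim_filter h2 h4).
    have rt0 : 0 < r - `|t - t'| by rewrite subr_gt0.
    apply: filterS (filterI (filterI (Uon t) (Uon t')) (Ukap _ rt0)) => i [[/= oi oi'] ki].
    rewrite fine_le ?(fin_le _ _ _ ts mA' (mle _ _ _ ts mA'))
      ?(fin_le _ _ _ ts' mN (mle _ _ _ ts' mN))//.
    have mv : moves r (m t i) (m t' i).
      have [tt|tt] := leP t t'.
        apply: (moves_le borel _ (mm t t' i ts ts' oi oi' tt)).
        by move: ki; rewrite distrC ger0_norm ?subr_ge0//; lra.
      apply: (moves_sym); apply: (moves_le borel _ (mm t' t i ts' ts oi' oi (ltW tt))).
      by move: ki; rewrite gtr0_norm ?subr_gt0//; lra.
    by have [] := mv _ mA'.
  move=> t t' r ts ts' tr A' mA'; split; first exact: half.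
  by apply: half => //; rewrite distrC.
exists A, B; split.
- apply: (limmoves A mA AP) => [|t t' i ts ts' oi oi' tt]; first by move=> t i A'; exact: mAle.
  rewrite /mA oi oi'.
  by have [_ _ _ /(_ t t' (onE _ _ ts oi) (onE _ _ ts' oi') tt)[]] := ABP i.
- apply: (limmoves B mB BP) => [|t t' i ts ts' oi oi' tt]; first by move=> t i A'; exact: mBle.
  rewrite /mB oi oi'.
  by have [_ _ _ /(_ t t' (onE _ _ ts oi) (onE _ _ ts' oi') tt)[]] := ABP i.
- move=> t ts A' mA'.
  have [a1 a2] := AP t ts _ mA'; have [b1 b2] := BP t ts _ mA'.
  have fa := fin_le _ _ _ ts mA' a1; have fb := fin_le _ _ _ ts mA' b1.
  rewrite -(fineK fa) -(fineK fb) -(fineK (nfin _ _ ts mA')) -EFinD; congr EFin.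
  have sum : (fun i => fine (mA t i A') + fine (mB t i A')) @ U -->
    (fine (A t A') + fine (B t A') : R) := cvgD a2 b2.
  have eqs : U [set i | fine (mA t i A') + fine (mB t i A') = fine (nu t A')].
    apply: filterS (Uon t) => i /= oi.
    have fa' := fin_le _ _ _ ts mA' (mAle t i A' ts mA').
    have fb' := fin_le _ _ _ ts mA' (mBle t i A' ts mA').
    rewrite -fineD//; congr fine; rewrite /mA /mB oi.
    have [_ _ H _] := ABP i.
    by apply/esym/(H t (onE _ _ ts oi)).
  have cst : (fun=> fine (nu t A')) @ U --> (fine (nu t A') : R) := cvg_cst _.
  apply/eqP; rewrite eq_le; apply/andP; split.
    by apply: (le_lim_filter (cst _) (sum _)); apply: filterS eqs => i /= ->.
  by apply: (le_lim_filter (sum _) (cst _)); apply: filterS eqs => i /= ->.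
- move=> A' mA'; have [a1 a2] := AP 0 s00 _ mA'.
  have la := addm_lel ab mA'.
  rewrite -(fineK (fin_le _ _ _ s00 mA' a1)) -(fineK (fin_le al _ _ s00 mA' la)).
  congr EFin; apply: (cvgu _ _ _ a2).
  rewrite (_ : (fun i => _) = fun=> fine (al A')); first exact: cvg_cst.
  by apply/funext => i; rewrite /mA on0; have [-> _ _ _] := ABP i.
- move=> A' mA'; have [a1 a2] := BP 0 s00 _ mA'.
  have la := addm_ler ab mA'.
  rewrite -(fineK (fin_le _ _ _ s00 mA' a1)) -(fineK (fin_le be _ _ s00 mA' la)).
  congr EFin; apply: (cvgu _ _ _ a2).
  rewrite (_ : (fun i => _) = fun=> fine (be A')); first exact: cvg_cst.
  by apply/funext => i; rewrite /mB on0; have [_ -> _ _] := ABP i.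
Qed.

End SplitCurve.

(** * Uniform continuity under transport *)

Section Continuity.
Context {R : realType} {d : measure_display} {X : measurableMetricType d R}.
Local Notation meas := {measure set X -> \bar R}.
Implicit Types (al be nu : meas) (A B : set X) (r : R).
Context (mu : meas) (Xmu : metric_measure_space mu).
Let borel := mms_borel Xmu.

(** Finitely many compact balls cover [S] with a margin; the smallest margin is the
width [e]. *)
Lemma compact_nbd (S : set X) : compact S ->
  exists (K : set X) (e : R), [/\ compact K, 0 < e & nbd e S `<=` K].
Proof.
move=> cS.
have loc (x : X) : exists Ve : set X * R, [/\ compact Ve.1, 0 < Ve.2 &
    [set y | mdist x y < Ve.2] `<=` Ve.1].
  have [V wV [cV _]] : compact_near (within [set: X] (nbhs x)) :=
    mms_locally_compact Xmu I.
  have /nbhs_ballP[e /= e0 eV] : nbhs x V.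
    have wV' : nbhs x [set y | [set: X] y -> V y] := wV.
    by apply: filterS wV' => y; apply.
  by exists (V, e); split => //; rewrite -ballEmdist.
have [Ve VeP] := choice loc.
have [s sS] : exists s : seq X, forall x, S x ->
    has (fun c => mdist c x < (Ve c).2 / 2) s.
  move: cS; rewrite compact_cover => /(_ X S (fun c => [set y | mdist c y < (Ve c).2 / 2])).
  case=> [c _|x Sx|s _ sS]; first exact: ball_open_metric.
    by exists x => //=; rewrite mdistxx divr_gt0//; have [] := VeP x.
  exists (finmap.enum_fset s) => x /sS[c cs xc]; apply/hasP; exists c => //.
have [e e0 es] : exists2 e : R, 0 < e & {in s, forall c, e <= (Ve c).2 / 2}.
  elim: (s) => [|c l [e e0 el]]; first by exists 1.
  exists (Num.min e ((Ve c).2 / 2)).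
    by rewrite lt_min e0 divr_gt0//; have [] := VeP c.
  move=> c'; rewrite inE => /orP[/eqP->|/el c'l]; rewrite ge_min ?lexx ?orbT//.
  by rewrite c'l.
exists (\big[setU/set0]_(c <- s) (Ve c).1), e; split => //.
  by apply: bigsetU_compact => c _; have [] := VeP c.
move=> y [x Sx xy]; have /hasP[c cs cx] := sS x Sx.
rewrite -bigcup_seq; exists c => //.
have [_ _] := VeP c; apply => /=.
rewrite (le_lt_trans (metric_triangle _ x _))// (splitr (Ve c).2) ltrD//.
by apply: lt_le_trans (es _ cs).
Qed.

Lemma compact_fin (K : set X) : compact K -> (mu K < +oo)%E.
Proof.
move=> cK; have mK := compact_borel borel cK.
pose b (c : X) : set X := [set y | mdist c y < 1].
have mb (c : X) : measurable (b c).
  exact: (open_borel borel (@ball_open_metric _ _ _ _ _)).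
have [s sK] : exists s : seq X, K `<=` \big[setU/set0]_(c <- s) (b c).
  move: cK; rewrite compact_cover => /(_ X K b).
  case=> [c _|x Kx|s _ sS]; first exact: ball_open_metric.
    by exists x => //=; rewrite /b/= mdistxx.
  exists (finmap.enum_fset s) => x /sS[c cs xc]; rewrite -bigcup_seq; exists c => //.
have ms l : measurable (\big[setU/set0]_(c <- l) (b c)).
  by apply: bigsetU_measurable => c _; exact: mb.
apply: le_lt_trans (meas_mono mu mK (ms s) sK) _.
elim: {sK} s => [|c l IH]; first by rewrite big_nil measure0.
rewrite big_cons; apply: le_lt_trans (meas_setU2 _ (mb c) (ms l)) _.
apply: lte_add_pinfty => //.
have := mms_ball Xmu c (@ltr01 R); rewrite ballEmdist => /andP[_].
exact.
Qed.

Section OnCompact.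
Context (K : set X) (cK : compact K).
Let mK : measurable K := compact_borel borel cK.
Let fK : (mu K < +oo)%E := compact_fin cK.

Definition carried al := (forall A, measurable A -> (al A <= mu A)%E) /\ al (~` K) = 0%E.

Lemma carried_I al A : carried al -> measurable A -> al A = al (A `&` K).
Proof.
move=> [_ aK] mA; apply/eqP; rewrite eq_le; apply/andP; split; last first.
  by apply: meas_mono => //; exact: measurableI.
have mAK := measurableI _ _ mA mK; have mAC := measurableI _ _ mA (measurableC mK).
have E : A = (A `&` K) `|` (A `&` ~` K) by rewrite -setIUr setUv setIT.
rewrite {1}E; apply: le_trans (meas_setU2 _ mAK mAC) _.
rewrite -[leRHS]adde0; apply: leeD2l; rewrite -aK.
by apply: meas_mono => //; exact: measurableC.
Qed.

Lemma carried_fin al : carried al -> (al setT < +oo)%E.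
Proof.
move=> aK; rewrite (carried_I aK measurableT) setTI.
by apply: le_lt_trans fK; apply aK.1.
Qed.

Lemma carried_diff al A B : carried al -> measurable A -> measurable B -> A `<=` B ->
  (al B <= al A + mu ((B `\` A) `&` K))%E.
Proof.
move=> aK mA mB AB.
have mD := measurableD mB mA.
have E : B = A `|` (B `\` A) by rewrite setDUK.
rewrite {1}E; apply: le_trans (meas_setU2 _ mA mD) _; apply: leeD2l.
by rewrite (carried_I aK mD); apply: aK.1; exact: measurableI.
Qed.

(** The measure of [A] changes little under transport over small distances,
uniformly in the transported measures. An upper bound is enough, by the symmetry
of [moves]. *)
Definition stable A := measurable A /\ forall dl : R, 0 < dl -> exists2 e : R, 0 < e &
  forall al al', carried al -> carried al' -> moves e al al' -> (al' A <= al A + dl%:E)%E.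

Lemma vanishing_tail (F : (set X)^nat) (dl : R) : (forall n, measurable (F n)) ->
  {homo F : n m / (n <= m)%N >-> m `<=` n} -> \bigcap_n F n = set0 -> 0 < dl ->
  exists n, (mu (F n `&` K) < dl%:E)%E.
Proof.
move=> mF F_ F0 dl0.
have : mu (F n `&` K) @[n --> \oo] --> mu (\bigcap_n (F n `&` K)).
  apply: nonincreasing_cvg_mu.
  - by apply: le_lt_trans fK; apply: meas_mono => //; exact: measurableI.
  - by move=> n; exact: measurableI.
  - by apply: bigcap_measurable => [|n _]; [exists 0%N|exact: measurableI].
  - by move=> n m nm; apply/subsetPset; apply: setSI; exact: F_.
rewrite (_ : \bigcap_n (F n `&` K) = set0); last first.
  rewrite -subset0 -F0 => x Hx n _; by have [] := Hx n I.
rewrite measure0 => /fine_cvgP[[N1 _ N1f] /cvgrPdist_lt/(_ _ dl0)[N2 _ N2d]].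
exists (maxn N1 N2).
have /= f1 := N1f (maxn N1 N2) (leq_maxl _ _).
have /= := N2d (maxn N1 N2) (leq_maxr _ _); rewrite sub0r normrN => h.
by rewrite -(fineK f1) lte_fin; apply: le_lt_trans h; exact: ler_norm.
Qed.

(** The mass that arrives in [C] comes from the neighbourhood [nbd e C], and what
this adds to [C] has small [mu]-measure within [K], uniformly in the measures
below [mu]. *)
Lemma closed_stable (C : set X) : closed C -> stable C.
Proof.
move=> clC; have mC := closed_borel borel clC; split => // dl dl0.
have [|||n nP] := @vanishing_tail (fun n => nbd n.+1%:R^-1 C `\` C) dl _ _ _ dl0.
- by move=> n; apply: measurableD => //; exact: nbd_meas.
- move=> n m nm; apply: setSD; apply: nbd_le.
  by rewrite lef_pV2 ?posrE// ler_nat.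
- rewrite -subset0 => x Hx; have [_ nC] := Hx 0%N I.
  apply: nC; rewrite (closure_id C).1// => V /nbhs_ballP[e /= e0 eV].
  have [n ne] := invSn_lt e0; have [[y Cy yx] _] := Hx n I.
  exists y; split => //; apply: eV; rewrite ballEmdist/= metric_sym.
  exact: lt_trans ne.
exists n.+1%:R^-1; first by rewrite invr_gt0.
move=> al al' aK a'K mv; have [_ h] := mv C mC.
apply: le_trans h _.
apply: le_trans (carried_diff aK mC (nbd_meas borel n.+1%:R^-1 C) _) _.
  by apply: sub_nbd; rewrite invr_gt0.
by apply: leeD2l; exact: ltW.
Qed.

Lemma stable_setD A B : stable A -> stable B -> B `<=` A -> stable (A `\` B).
Proof.
move=> [mA sA] [mB sB] BA; have mD := measurableD mA mB; split => // dl dl0.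
have dl2 : 0 < dl / 2 by rewrite divr_gt0.
have [e1 e10 H1] := sA _ dl2; have [e2 e20 H2] := sB _ dl2.
exists (Num.min e1 e2); first by rewrite lt_min e10.
move=> al al' aK a'K mv.
have mv1 : moves e1 al al' by apply: (moves_le borel _ mv); rewrite ge_min lexx.
have mv2 : moves e2 al' al.
  by apply/moves_sym/(moves_le borel _ mv); rewrite ge_min lexx orbT.
have h1 := H1 _ _ aK a'K mv1; have h2 := H2 _ _ a'K aK mv2.
have decomp (g : meas) : carried g -> g A = (g B + g (A `\` B))%E.
  move=> gK; have E : A = B `|` (A `\` B) by rewrite setDUK.
  rewrite {1}E; apply: meas_setU => //.
  by apply/seteqP; split => // x [Bx [_]].
have fin g C : carried g -> measurable C -> g C \is a fin_num.
  by move=> /carried_fin fg; exact: finite_meas_fin_num.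
move: h1 h2; rewrite !decomp//.
rewrite -(fineK (fin _ _ aK mB)) -(fineK (fin _ _ a'K mB)).
rewrite -(fineK (fin _ _ aK mD)) -(fineK (fin _ _ a'K mD)) -!EFinD !lee_fin; lra.
Qed.

(** Stable sets form a lambda-system that contains the open sets. *)
Lemma stable_meas A : measurable A -> stable A.
Proof.
have sT : stable setT.
  split => // dl dl0; exists 1 => // al al' _ _ mv.
  by rewrite (moves_mass ltr01 mv) leeDl// lee_fin ltW.
suff sub : <<s @open X >> `<=` stable by rewrite borel; exact: sub.
apply: lambda_system_subset => //.
- by move=> ? ?; exact: openI.
- split => //.
  + by move=> A' B' BA sA sB; exact: stable_setD.
  + move=> F ndF sF.
    have mF n : measurable (F n) := (sF n).1.
    have mU : measurable (\bigcup_n F n) by exact: bigcup_measurable.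
    split => // dl dl0.
    have dl2 : 0 < dl / 2 by rewrite divr_gt0.
    have [|||n nP] := @vanishing_tail (fun n => (\bigcup_n F n) `\` F n) (dl / 2) _ _ _ dl2.
    * by move=> n; exact: measurableD.
    * move=> n m nm; apply: setDS; exact/subsetPset/ndF.
    * rewrite -subset0 => x Hx; have [[n _ Fnx] _] := Hx 0%N I.
      by have [_] := Hx n I.
    have [e e0 H] := (sF n).2 _ dl2; exists e => // al al' aK a'K mv.
    have sub : F n `<=` \bigcup_n F n by exact: bigcup_sup.
    apply: le_trans (carried_diff a'K (mF n) mU sub) _.
    rewrite (splitr dl) EFinD addeA; apply: leeD; last exact: ltW.
    apply: le_trans (H _ _ aK a'K mv) _; apply: leeD2r.
    exact: meas_mono.
- move=> A' oA; rewrite -(setCK A') -setTD; apply: stable_setD => //.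
  exact/closed_stable/open_closedC.
Qed.

Context (g : X -> R) (mg : measurable_fun [set: X] g) (g0 : forall x, 0 <= g x).
Context (fg : (\int[mu]_(x in K) (g x)%:E < +oo)%E).

Import HBNNSimple.

(** An approximation of [g] from below in the mean with respect to [mu] on [K] is
one with respect to all measures below [mu]. *)
Lemma simple_below (dl : R) : 0 < dl -> exists h : {nnsfun X >-> R},
  forall al, carried al -> (\int[al]_x (h x)%:E <= \int[al]_x (g x)%:E <=
    \int[al]_x (h x)%:E + dl%:E)%E.
Proof.
move=> dl0; pose gK : X -> \bar R := (EFin \o g) \_ K.
have gK0 x : (0 <= gK x)%E by rewrite /gK /patch; case: ifP => //= _; rewrite lee_fin.
have mgK : measurable_fun setT gK.
  by apply/(measurable_restrictT _ mK)/measurable_EFinP/measurable_funTS.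
have fgK : (\int[mu]_x gK x)%E \is a fin_num.
  by rewrite ge0_fin_numE ?integral_ge0// -integral_mkcond.
have := fgK; rewrite ge0_integralTE// => fsup.
have [_ [h hg <-] hlt] := ub_ereal_sup_adherent dl0 fsup.
exists h => al aK.
have mh : measurable_fun setT (fun x => (h x)%:E) by exact/measurable_EFinP.
have h0 x : (0 <= (h x)%:E)%E by rewrite lee_fin.
have mgE : measurable_fun setT (fun x => (g x)%:E) by exact/measurable_EFinP.
have gE0 x : (0 <= (g x)%:E)%E by rewrite lee_fin.
have gE : (\int[al]_x (g x)%:E = \int[al]_x gK x)%E.
  rewrite -(setUv K) ge0_integral_setU//.
  - rewrite [X in (_ + X)%E](_ : _ = 0%E) ?adde0; first by rewrite setUv -integral_mkcond.
    by apply: null_set_integral => //; [exact: measurableC|exact: measurable_funTS mgE|exact: aK.2].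
  - exact: measurableC.
  - by rewrite setUv.
  - by apply/disj_setPS => x [].
rewrite gE; apply/andP; split; first exact: ge0_le_integral.
have mdiff : measurable_fun setT (fun x => gK x - (h x)%:E)%E by exact: emeasurable_funB.
have diff0 x : (0 <= gK x - (h x)%:E)%E by rewrite sube_ge0.
have gKE x : gK x = ((h x)%:E + (gK x - (h x)%:E))%E by rewrite addeC subeK.
have sum (nu : meas) : (\int[nu]_x gK x = \int[nu]_x (h x)%:E + \int[nu]_x (gK x - (h x)%:E))%E.
  by rewrite -ge0_integralD//; apply: eq_integral => x _; exact: gKE.
rewrite sum leeD2l//; apply: le_trans (ge0_le_measure_integral aK.1 measurableT diff0 mdiff) _.
move: hlt; rewrite -ge0_integralTE// sum -integralT_nnsfun.
have fh : (\int[mu]_x (h x)%:E)%E \is a fin_num.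
  move: fgK; rewrite sum fin_numD => /andP[]//.
have fd : (\int[mu]_x (gK x - (h x)%:E))%E \is a fin_num.
  move: fgK; rewrite sum fin_numD => /andP[]//.
by rewrite lteBlDr// lteD2lE//; exact: ltW.
Qed.

Lemma nnsfun_sum (h : {nnsfun X >-> R}) : exists l : seq R, all (>= 0) l /\
  forall al, (\int[al]_x (h x)%:E = \sum_(y <- l) y%:E * al (h @^-1` [set y]))%E.
Proof.
exists (finmap.enum_fset (fset_set (range h))); split.
  apply/allP => y yl; have : y \in range h by rewrite -in_fset_set//; exact: yl.
  by rewrite inE => -[x _ <-] /=.
by move=> al; rewrite integralT_nnsfun sintegralE fsbig_finite.
Qed.

(** For the simple function of [simple_below] this is a finite sum of instances of
[stable_meas]. *)
Lemma int_moves (dl : R) : 0 < dl -> exists2 e : R, 0 < e &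
  forall al al', carried al -> carried al' -> moves e al al' ->
    (\int[al']_x (g x)%:E <= \int[al]_x (g x)%:E + dl%:E)%E.
Proof.
move=> dl0; have dl2 : 0 < dl / 2 by rewrite divr_gt0.
have [h hP] := simple_below dl2; have [l [l0 hE]] := nnsfun_sum h.
have [e e0 H] : exists2 e : R, 0 < e & forall al al', carried al -> carried al' ->
    moves e al al' -> (\sum_(y <- l) y%:E * al' (h @^-1` [set y]) <=
       \sum_(y <- l) y%:E * al (h @^-1` [set y]) + (dl / 2)%:E)%E.
  elim: l l0 (dl / 2) dl2 {hE} => [|y l IH] /=.
    by move=> _ e e0; exists 1 => // al al' *; rewrite !big_nil add0e lee_fin ltW.
  move=> /andP[y0 l0] e e0; have e20 : 0 < e / 2 by rewrite divr_gt0.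
  have [e1 e10 H1] := IH l0 _ e20.
  have y1 : 0 < y + 1 by rewrite ltr_wpDl.
  have mh : measurable (h @^-1` [set y]) by [].
  have [e2 e22 H2] := (stable_meas mh).2 (e / 2 / (y + 1)) (divr_gt0 e20 y1).
  exists (Num.min e1 e2); first by rewrite lt_min e10.
  move=> al al' aK a'K mv; rewrite !big_cons (splitr e) EFinD addeACA.
  have mv1 : moves e1 al al' by apply: (moves_le borel _ mv); rewrite ge_min lexx.
  have mv2 : moves e2 al al' by apply: (moves_le borel _ mv); rewrite ge_min lexx orbT.
  apply: leeD; last exact: H1.
  have := H2 _ _ aK a'K mv2.
  have f1 : al (h @^-1` [set y]) \is a fin_num by apply: finite_meas_fin_num mh; exact: carried_fin.
  have f2 : al' (h @^-1` [set y]) \is a fin_num by apply: finite_meas_fin_num mh; exact: carried_fin.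
  rewrite -(fineK f1) -(fineK f2) -!EFinM -!EFinD !lee_fin => H.
  apply: le_trans (ler_wpM2l y0 H) _; rewrite mulrDr lerD2l.
  by rewrite mulrCA ler_piMr ?ltW// ltr_pdivrMr// mul1r ltrDl.
exists e => // al al' aK a'K mv.
have /andP[_ h1] := hP _ a'K; have /andP[h2 _] := hP _ aK.
apply: le_trans h1 _.
rewrite [X in (_ <= _ + X%:E)%E](splitr dl) EFinD addeA leeD2r// hE.
by apply: le_trans (H _ _ aK a'K mv) _; rewrite leeD2r// -hE.
Qed.

(** The simple function of [simple_below] is bounded. *)
Lemma int_small (dl : R) : 0 < dl -> exists2 kap : R, 0 < kap &
  forall al, carried al -> (al setT <= kap%:E)%E -> (\int[al]_x (g x)%:E <= dl%:E)%E.
Proof.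
move=> dl0; have dl2 : 0 < dl / 2 by rewrite divr_gt0.
have [h hP] := simple_below dl2; have [l [l0 hE]] := nnsfun_sum h.
pose M := \sum_(y <- l) y.
have M0 : 0 <= M by rewrite /M big_seq sumr_ge0// => y yl; exact: (allP l0).
have M1 : 0 < M + 1 by rewrite ltr_wpDl.
exists (dl / 2 / (M + 1)); first by rewrite divr_gt0.
move=> al aK aT; have /andP[_ h1] := hP _ aK.
apply: le_trans h1 _; rewrite [X in (_ <= X%:E)%E](splitr dl) EFinD leeD2r// hE.
apply: (@le_trans _ _ (\sum_(y <- l) y%:E * al setT)%E).
  rewrite big_seq [leRHS]big_seq; apply: lee_sum => y yl.
  by apply: lee_wpmul2l; [rewrite lee_fin; exact: (allP l0)|exact: meas_mono].
have fT : al setT \is a fin_num by apply: finite_meas_fin_num => //; exact: carried_fin.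
move: aT; rewrite -(fineK fT) lee_fin => aT.
under eq_bigr do rewrite -EFinM.
rewrite sumEFin -mulr_suml lee_fin -/M.
apply: le_trans (ler_wpM2l M0 aT) _.
by rewrite mulrCA ler_piMr ?ltW// ltr_pdivrMr// mul1r ltrDl.
Qed.

End OnCompact.
End Continuity.

(** * Slopes along curves and upper gradients *)

Section Slopes.
Context {R : realType} {d : measure_display} {X : measurableMetricType d R}.
Local Notation meas := {measure set X -> \bar R}.
Implicit Types (al be nu eta : meas) (A B : set X) (r : R).
Context (mu : meas) (Xmu : metric_measure_space mu).
Let borel := mms_borel Xmu.

Lemma L1loc_integrable (f : X -> R) al : L1loc mu f -> inM mu al ->
  al.-integrable [set: X] (EFin \o f).
Proof.
move=> [mf ff] [fa sa am].
have mE : measurable_fun [set: X] (EFin \o f) by exact/measurable_EFinP.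
apply/integrableP; split => //.
pose K := supp al; have mK : measurable K := supp_meas Xmu al.
have mabs : measurable_fun [set: X] (fun x => `|(EFin \o f) x|)%E.
  exact: measurableT_comp.
rewrite -(setUv K) ge0_integral_setU//.
- rewrite [X in (_ + X)%E](_ : _ = 0%E) ?adde0.
    apply: le_lt_trans (ff _ sa).
    exact: (ge0_le_measure_integral am mK).
  apply: null_set_integral; [exact: measurableC|exact: measurable_funTS mabs|].
  exact: (supp_null Xmu).
- exact: measurableC.
- by rewrite setUv.
- by apply/disj_setPS => x [].
Qed.

Lemma eqm_integral (f : X -> R) al be : eqm al be -> \int[al]_x f x = \int[be]_x f x.
Proof.
by move=> E; congr fine; apply: eq_measure_integral => A mA _; exact: E.
Qed.

Lemma addm_integral (f : X -> R) al be nu : addm al be nu ->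
  al.-integrable [set: X] (EFin \o f) -> be.-integrable [set: X] (EFin \o f) ->
  \int[nu]_x f x = \int[al]_x f x + \int[be]_x f x.
Proof.
move=> E fa fb.
have -> : \int[nu]_x f x = \int[measure_add al be]_x f x.
  by apply: eqm_integral => A mA; rewrite E//; apply/esym; exact: measure_addE.
rewrite /Rintegral integral_measure_add//.
by rewrite fineD//; exact: integrable_fin_num.
Qed.

Lemma eq_off_integral (f f' : X -> R) al A : measurable_fun [set: X] f ->
  measurable_fun [set: X] f' -> measurable A -> al A = 0%E ->
  (forall x, ~ A x -> f x = f' x) -> \int[al]_x f x = \int[al]_x f' x.
Proof.
move=> mf mf' mA A0 ff; congr fine; apply: ae_eq_integral => //.
- exact/measurable_EFinP.
- exact/measurable_EFinP.
- exists A; split => // x /= H; apply: contrapT => nA; apply: H => _.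
  by rewrite ff.
Qed.

Lemma null_integral (f : X -> R) al : measurable_fun [set: X] f ->
  al setT = 0%E -> \int[al]_x f x = 0.
Proof.
move=> mf a0; rewrite (@eq_off_integral f (cst 0) al setT)//; last by move=> x [].
by rewrite Rintegral_cst// mul0r.
Qed.

Lemma le_measure_Rintegral (f : X -> R) al be : (forall x, 0 <= f x) ->
  (forall A, measurable A -> (al A <= be A)%E) ->
  al.-integrable [set: X] (EFin \o f) -> be.-integrable [set: X] (EFin \o f) ->
  \int[al]_x f x <= \int[be]_x f x.
Proof.
move=> f0 ab fa fb; rewrite fine_le//; try exact: integrable_fin_num.
apply: (ge0_le_measure_integral ab measurableT); last exact: measurable_int fa.
by move=> x; rewrite lee_fin.
Qed.

Context (h : R -> R) (hh : gauge h).

Lemma r_eps_le (F : meas -> R) eta (e e' : R) : e <= e' ->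
  (r_eps mu h F eta e <= r_eps mu h F eta e')%E.
Proof.
move=> ee; apply: ereal_sup_le => _ [b [nu [s [lc n0 /andP[s0 se] ->]]]].
exists b, nu, s; split => //; rewrite s0/=.
by move: se; rewrite !lt_min => /andP[se ->]; rewrite andbT; exact: lt_le_trans ee.
Qed.

(** The suprema [r_eps] are monotone in their last argument. *)
Lemma r_limE (F : meas -> R) eta :
  r_lim mu h F eta = ereal_inf [set r_eps mu h F eta e | e in `]0, +oo[].
Proof.
apply: cvg_lim => //; apply: nondecreasing_at_right_cvge => //.
by move=> x y _ _; exact: r_eps_le.
Qed.

Lemma r_lim_slope (F : meas -> R) eta (M : R) : (r_lim mu h F eta < M%:E)%E ->
  exists2 e : R, 0 < e & forall b (nu : R -> meas) s, lip_curve mu h b nu -> eqm (nu 0) eta ->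
    0 < s < Num.min e b -> `|F (nu s) - F eta| <= M * s.
Proof.
rewrite r_limE => /ereal_inf_lt[_ [e /= e0 <-] lM].
have {}e0 : 0 < e by move: e0; rewrite in_itv/= andbT.
exists e => // b nu s lc n0 sb.
rewrite -ler_pdivrMr; last by case/andP: sb.
rewrite -lee_fin; apply: le_trans (ltW lM).
by apply: ereal_sup_ubound; exists b, nu, s; split.
Qed.

Lemma r_lim_le (F : meas -> R) eta (M e : R) : 0 < e ->
  (forall b (nu : R -> meas) s, lip_curve mu h b nu -> eqm (nu 0) eta ->
    0 < s < Num.min e b -> `|F (nu s) - F eta| <= M * s) ->
  (r_lim mu h F eta <= M%:E)%E.
Proof.
move=> e0 H; rewrite r_limE; apply: (@le_trans _ _ (r_eps mu h F eta e)).
  by apply: ereal_inf_lbound; exists e => //=; rewrite in_itv/= e0.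
apply: ge_ereal_sup => _ [b [nu [s [lc n0 sb ->]]]].
rewrite lee_fin ler_pdivrMr; last by case/andP: sb.
exact: H sb.
Qed.

Lemma r_lim_witness (F : meas -> R) eta (M e : R) : 0 < e ->
  (M%:E < r_lim mu h F eta)%E ->
  exists b (nu : R -> meas) s, [/\ lip_curve mu h b nu, eqm (nu 0) eta,
    0 < s < Num.min e b & M * s < `|F (nu s) - F eta| ].
Proof.
move=> e0; rewrite r_limE => lM.
have : (M%:E < r_eps mu h F eta e)%E.
  apply: lt_le_trans lM _.
  by apply: ereal_inf_lbound; exists e => //=; rewrite in_itv/= e0.
move=> /ereal_sup_gt[_ [b [nu [s [lc n0 sb ->]]]]]; rewrite lte_fin.
rewrite ltr_pdivlMr; last by case/andP: sb.
by move=> H; exists b, nu, s; split.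
Qed.

Lemma r_lim_ge (F : meas -> R) eta (M : R) :
  (forall e : R, 0 < e -> exists b (nu : R -> meas) s, [/\ lip_curve mu h b nu, eqm (nu 0) eta,
    0 < s < Num.min e b & M * s <= `|F (nu s) - F eta| ]) ->
  (M%:E <= r_lim mu h F eta)%E.
Proof.
move=> H; rewrite r_limE; apply: le_ereal_inf_tmp => _ [e /= e0 <-].
have {}e0 : 0 < e by move: e0; rewrite in_itv/= andbT.
have [b [nu [s [lc n0 sb Ms]]]] := H e e0.
apply: (@le_trans _ _ (`|F (nu s) - F eta| / s)%:E).
  by rewrite lee_fin ler_pdivlMr//; case/andP: sb.
by apply: ereal_sup_ubound; exists b, nu, s; split.
Qed.

Lemma moving_curve_mass (s : R) (al : R -> meas) t : moving_curve s al -> 0 <= t <= s ->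
  al t setT = al 0 setT.
Proof.
move=> ha ts; have s0 : 0 <= (0 : R) <= s.
  by case/andP: ts => t0 ts; rewrite lexx (le_trans t0).
have t1 : 0 < `|t - 0| + 1 by rewrite ltr_wpDl.
by apply: (moves_mass t1); apply: ha => //; rewrite ltrDl.
Qed.

Context (k gk : X -> R) (kgk : upper_gradient mu h k gk).

(** At every time the slope of the average of [k] is the average of [gk], which the
bound [G] controls. The slope only looks into the future, but reversing time
turns the curve into another Lipschitz curve, so the increments of the integral
of [k] are controlled on both sides of every time and [local_lipschitz]
applies. *)
Lemma increment (s G : R) (al : R -> meas) : 0 <= s -> moving_curve s al ->
  (forall t, 0 <= t <= s -> inM mu (al t)) ->
  (forall t, 0 <= t <= s -> \int[al t]_x `|gk x| <= G) ->
  `|\int[al s]_x k x - \int[al 0]_x k x| <= G * s.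
Proof.
move=> s0 ha Ma HG; have [Lk Lg ug] := kgk.
have s00 : 0 <= (0 : R) <= s by rewrite lexx.
have ss : 0 <= s <= s by rewrite lexx andbT.
have G0 : 0 <= G by apply: le_trans (HG 0 s00); apply: Rintegral_ge0.
have [m0|m0] := eqVneq (al 0 setT) 0%E.
  rewrite !null_integral ?subrr ?normr0 ?mulr_ge0//; try exact: Lk.1.
  by rewrite (moving_curve_mass ha ss).
have [fa _ _] := Ma 0 s00.
have f0 : al 0 setT \is a fin_num by exact: finite_meas_fin_num.
pose m := fine (al 0 setT).
have m_gt0 : 0 < m by rewrite fine_gt0// fa lt0e m0 measure_ge0.
have mE t : 0 <= t <= s -> fine (al t setT) = m.
  by move=> ts; rewrite (moving_curve_mass ha ts).
apply/ler_addgt0Pr => eps eps0.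
have s1 : 0 < s + 1 by rewrite ltr_wpDl.
pose ee := eps / (s + 1); have ee0 : 0 < ee by rewrite divr_gt0.
apply: (@le_trans _ _ ((G + ee) * s)); last first.
  by rewrite mulrDl lerD2l /ee -mulrA ler_piMr ?ltW// mulrC ltr_pdivrMr// mul1r ltrDl.
apply: (@local_lipschitz _ (fun t => \int[al t]_x k x)) => // t ts.
have Xt : inX mu (al t) by split; [exact: Ma|rewrite (moving_curve_mass ha ts)].
have : (r_lim mu h (Favg k) (al t) < (m^-1 * (G + ee))%:E)%E.
  rewrite ug// lte_fin /Favg mE// ltr_pM2l ?invr_gt0//.
  apply: (@le_lt_trans _ _ G); last by rewrite ltrDl.
  apply: le_trans (HG t ts).
  apply: le_trans (ler_norm _) _; apply: le_normr_Rintegral => //.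
  exact: L1loc_integrable (Ma t ts).
move=> /r_lim_slope[e e0 H]; exists e => // t' ts' tt'.
have [->|tn] := eqVneq t' t; first by rewrite !subrr normr0 mulr0.
(* [nu] runs from time [t] in the direction of [t'], and [clamp] stops it at the
   ends of the interval, so that it is defined up to the time [s + 1]. *)
pose sg := if t <= t' then 1 else -1 : R.
have sgE : sg * `|t' - t| = t' - t.
  by rewrite /sg; case: leP => tt; [rewrite mul1r ger0_norm ?subr_ge0|
    rewrite mulN1r ltr0_norm ?subr_lt0// opprK].
have sg1 : `|sg| = 1 by rewrite /sg; case: ifP; rewrite ?normrN normr1.
pose clamp (x : R) := Num.max 0 (Num.min x s).
have clampin x : 0 <= clamp x <= s.
  by rewrite /clamp le_max lexx/= ge_max s0 ge_min lexx orbT.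
have clampid x : 0 <= x <= s -> clamp x = x.
  by move=> /andP[x0 xs]; rewrite /clamp (min_idPl xs) (max_idPr x0).
have clamp1 x y : `|clamp x - clamp y| <= `|x - y|.
  exact: le_trans (max0_lip _ _) (mins_lip _ _ _).
pose nu u := al (clamp (t + sg * u)).
have lc : lip_curve mu h (s + 1) nu.
  split; first exact: ltW.
    move=> u _; split; first exact: Ma.
    by rewrite /nu (moving_curve_mass ha).
  move=> u v _ _; apply: (moves_dM Xmu hh); [exact: Ma|exact: Ma|exact: normr_ge0|].
  move=> r ur; apply: ha => //; apply: le_lt_trans (clamp1 _ _) _.
  by rewrite opprD addrACA subrr add0r -mulrBr normrM sg1 mul1r.
have n0 : eqm (nu 0) (al t) by move=> A mA; rewrite /nu mulr0 addr0 clampid.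
have := H _ _ `|t' - t| lc n0.
have -> : nu `|t' - t| = al t' by rewrite /nu sgE subrKC clampid.
rewrite normr_gt0 subr_eq0 tn lt_min tt'/= /Favg !mE// -mulrBr normrM.
rewrite (gtr0_norm (x := m^-1)) ?invr_gt0// -mulrA ler_pM2l ?invr_gt0//; apply.
move: ts ts' => /andP[? ?] /andP[? ?]; rewrite ltr_norml; apply/andP; split; lra.
Qed.

End Slopes.

(** * Truncation: the upper bound *)

Section Truncation.
Context {R : realType} {d : measure_display} {X : measurableMetricType d R}.
Local Notation meas := {measure set X -> \bar R}.
Implicit Types (al be eta : meas) (A B : set X) (r : R).
Context (mu : meas) (Xmu : metric_measure_space mu).
Let borel := mms_borel Xmu.

Lemma L1loc_bound (f g : X -> R) (C : R) : measurable_fun [set: X] f ->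
  (forall x, `|f x| <= `|g x| + C) -> 0 <= C -> L1loc mu g -> L1loc mu f.
Proof.
move=> mf fg C0 [mg ig]; split => // K cK.
have mK := compact_borel borel cK.
have mabs (u : X -> R) : measurable_fun [set: X] u -> measurable_fun K (fun x => `|u x|).
  by move=> mu_; apply/measurable_funTS/measurableT_comp.
apply: (@le_lt_trans _ _ (\int[mu]_(x in K) (`|g x| + C)%:E)%E).
  apply: ge0_le_integral => //.
  - exact/measurable_EFinP/mabs.
  - by apply/measurable_EFinP/measurable_funD => //; exact: mabs.
  - by move=> x _; rewrite lee_fin.
under eq_integral do rewrite EFinD.
rewrite ge0_integralD//; last exact/measurable_EFinP/mabs.
apply: lte_add_pinfty; first exact: ig.
rewrite integral_cst//; apply: lte_mul_pinfty => //.
exact: compact_fin.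
Qed.

Lemma L1loc_abs (f : X -> R) : L1loc mu f -> L1loc mu (fun x => `|f x|).
Proof.
move=> Lf; apply: (L1loc_bound (g := f) (C := 0)) => //.
  by apply: measurableT_comp => //; exact: Lf.1.
by move=> x; rewrite normr_id addr0.
Qed.

Lemma L1loc_restr (f : X -> R) A : measurable A -> L1loc mu f ->
  L1loc mu (fun x => f x * \1_A x).
Proof.
move=> mA Lf; apply: (L1loc_bound (g := f) (C := 0)) => //.
  by apply: measurable_funM => //; exact: Lf.1.
move=> x; rewrite addr0 normrM ler_piMr// indicE.
by case: (x \in A); rewrite ?normr1 ?normr0.
Qed.

Lemma lt_set_meas (f f' : X -> R) : measurable_fun [set: X] f ->
  measurable_fun [set: X] f' -> measurable [set x | f x < f' x].
Proof.
move=> mf mf'.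
rewrite (_ : [set x | _] = [set: X] `&` (f' \- f) @^-1` `]0, +oo[).
  by apply: measurable_funB.
by apply/seteqP; split => x /=; rewrite in_itv/= andbT subr_gt0; [split|case].
Qed.

Lemma restr_split al A : measurable A -> exists be be' : meas,
  [/\ addm be be' al, be (~` A) = 0%E & be' A = 0%E].
Proof.
move=> mA; exists (mrestr al mA), (mrestr al (measurableC mA)); split.
- move=> B mB; rewrite /= /mrestr -meas_setU; first by rewrite -setIUr setUv setIT.
  + exact: measurableI.
  + by apply: measurableI => //; exact: measurableC.
  + by rewrite setIACA setICr setI0.
- by rewrite /= /mrestr setICl measure0.
- by rewrite /= /mrestr setICr measure0.
Qed.

Lemma moving_curve_rev (s : R) (al : R -> meas) : moving_curve s al ->
  moving_curve s (fun t => al (s - t)).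
Proof.
move=> ha t t' r /andP[t0 ts] /andP[t0' ts'] tr; apply: ha.
- by rewrite subr_ge0 ts/= gerBl.
- by rewrite subr_ge0 ts'/= gerBl.
- have -> : s - t - (s - t') = t' - t by ring.
  by rewrite distrC.
Qed.

Lemma le_null al be A : (forall A, measurable A -> (al A <= be A)%E) ->
  measurable A -> be A = 0%E -> al A = 0%E.
Proof.
by move=> ab mA bA; apply/eqP; rewrite eq_le measure_ge0 andbT -bA; exact: ab.
Qed.

Lemma full_null al A : (al setT < +oo)%E -> measurable A -> (al setT <= al A)%E ->
  al (~` A) = 0%E.
Proof.
move=> fa mA aA; have mC := measurableC mA.
have E : al setT = (al A + al (~` A))%E.
  by rewrite -(setUv A); apply: meas_setU => //; rewrite setICr.
have f1 := finite_meas_fin_num fa mA; have f2 := finite_meas_fin_num fa mC.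
move: aA; rewrite E -(fineK f1) -(fineK f2) -EFinD lee_fin gerDl => H.
by congr EFin; apply/eqP; rewrite eq_le H fine_ge0.
Qed.

(** A splitting according to the end of a curve is a splitting of the reversed curve
according to its start. *)
Lemma moving_curve_split_end (s : R) (nu : R -> meas) A : 0 <= s -> moving_curve s nu ->
  (forall t, 0 <= t <= s -> inM mu (nu t)) -> measurable A ->
  exists N1 N2 : R -> meas, [/\ moving_curve s N1, moving_curve s N2,
    forall t, 0 <= t <= s -> addm (N1 t) (N2 t) (nu t),
    N1 s (~` A) = 0%E & N2 s A = 0%E].
Proof.
move=> s0 hn Mn mA.
have rev t : 0 <= t <= s -> 0 <= s - t <= s.
  by move=> /andP[t0 ts]; rewrite subr_ge0 ts gerBl.
have [al [be [ab aA bA]]] := restr_split (nu s) mA.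
have ab' : addm al be (nu (s - 0)) by rewrite subr0.
have [A1 [A2 [h1 h2 E a0 b0]]] := moving_curve_split Xmu s0 (moving_curve_rev hn)
  (fun t ts => Mn _ (rev t ts)) ab'.
exists (fun t => A1 (s - t)), (fun t => A2 (s - t)); split.
- exact: moving_curve_rev.
- exact: moving_curve_rev.
- by move=> t ts; have := E _ (rev t ts); rewrite subKr.
- by rewrite subrr a0//; exact: measurableC.
- by rewrite subrr b0.
Qed.

Context (h : R -> R) (hh : gauge h) (k gk : X -> R) (kgk : upper_gradient mu h k gk).
Context (c : R).
Let phi x := Num.min (k x) c.
Let E := [set y | k y < c].
Let Lk : L1loc mu k. Proof. by case: kgk. Qed.
Let Lg : L1loc mu gk. Proof. by case: kgk. Qed.
Let mk : measurable_fun [set: X] k := Lk.1.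

Let mE : measurable E := lt_set_meas mk (measurable_cst c).

Lemma L1loc_min : L1loc mu phi.
Proof.
apply: (L1loc_bound (g := k) (C := `|c|)) => //.
- by apply: measurable_minr.
- by move=> x; rewrite /phi; case: (leP (k x) c) => _; rewrite ?lerDl ?lerDr.
Qed.
Let Lphi := L1loc_min.

Lemma phi_below al : al (~` E) = 0%E -> \int[al]_x phi x = \int[al]_x k x.
Proof.
move=> aE; apply: (eq_off_integral (A := ~` E)) => //.
- exact: Lphi.1.
- exact: measurableC.
- by move=> x /contrapT kc; rewrite /phi min_l// ltW.
Qed.

Lemma phi_above al : al E = 0%E -> \int[al]_x phi x = c * fine (al setT).
Proof.
move=> aE; rewrite -Rintegral_cst//; apply: (eq_off_integral (A := E)) => //.
  exact: Lphi.1.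
by move=> x /negP; rewrite -leNgt => ck; rewrite /phi min_r.
Qed.

Lemma phi_lek al : inM mu al -> \int[al]_x phi x <= \int[al]_x k x.
Proof.
move=> Ma; apply: le_Rintegral => //.
- exact (L1loc_integrable Xmu Lphi Ma).
- exact (L1loc_integrable Xmu Lk Ma).
- by move=> x _; rewrite /phi ge_min lexx.
Qed.

Lemma phi_lec al : inM mu al -> \int[al]_x phi x <= c * fine (al setT).
Proof.
move=> Ma; rewrite -Rintegral_cst//; apply: le_Rintegral => //.
- exact (L1loc_integrable Xmu Lphi Ma).
- have Lc : L1loc mu (cst c : X -> R).
    by apply: (L1loc_bound (g := k) (C := `|c|)) => // x; rewrite lerDr.
  exact (L1loc_integrable Xmu Lc Ma).
- by move=> x _; rewrite /phi ge_min lexx orbT.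
Qed.

(** When the mass starts on one side of the level [c] and ends on one side, the
truncation [phi] is either equal to [k] or constant at both ends. In the mixed
cases [c] times the mass lies between the two integrals of [k]. *)
Lemma phi_increment al be : inM mu al -> inM mu be -> al setT = be setT ->
  al E = 0%E \/ al (~` E) = 0%E -> be E = 0%E \/ be (~` E) = 0%E ->
  `|\int[be]_x phi x - \int[al]_x phi x| <= `|\int[be]_x k x - \int[al]_x k x|.
Proof.
move=> Ma Mb ab.
have a1 := phi_lek Ma; have a2 := phi_lec Ma; have b1 := phi_lek Mb; have b2 := phi_lec Mb.
rewrite ab in a2.
case=> aE; case=> bE.
- by rewrite !phi_above// ab subrr normr0.
- rewrite (phi_above aE) (phi_below bE) ab in a1 a2 b1 b2 *.
  by rewrite !ler0_norm ?subr_le0//; lra.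
- rewrite (phi_above bE) (phi_below aE) in a1 a2 b1 b2 *.
  by rewrite !ger0_norm ?subr_ge0//; lra.
- by rewrite !phi_below.
Qed.

(** The curve is split by its start and then by its end into the parts [A1] (from
[E] to [E]), [A2] (from [E] out), [B1] (into [E]) and [B2] (outside [E] at both
ends). The integral of [phi] does not change along [B2]. On [A1] and [A2] its
increment is bounded by that of [k], hence by the integral of [|gk|] at the
start, and these starts add up to the restriction of [eta] to [E]. The part
[B1] has small mass, because at the end the part that started outside [E] still
has almost no mass in [E]. *)
Lemma upper_slope eta (dl : R) : inX mu eta -> 0 < dl ->
  exists2 e : R, 0 < e & forall b (nu : R -> meas) s, lip_curve mu h b nu ->
    eqm (nu 0) eta -> 0 < s < Num.min e b ->
    `|\int[nu s]_x phi x - \int[eta]_x phi x| <=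
      (\int[eta]_x (`|gk x| * \1_E x) + dl) * s.
Proof.
move=> [Meta _] dl0.
have [feta seta _] := Meta.
have [K [e0 [cK e00 sK]]] := compact_nbd Xmu seta.
have mK := compact_borel borel cK.
pose g x := `|gk x|.
have Lg' : L1loc mu g := L1loc_abs Lg.
have g0 x : 0 <= g x by exact: normr_ge0.
have fgK : (\int[mu]_(x in K) (g x)%:E < +oo)%E by apply: Lg.2.
(* one third of the error for each of the parts [A1], [A2] and [B1] *)
have dl3 : 0 < dl / 3 by rewrite divr_gt0.
have [e1 e10 H1] := int_moves Xmu cK Lg'.1 g0 fgK dl3.
have [kap kap0 Hk] := int_small Xmu cK Lg'.1 g0 fgK dl3.
have [e2 e20 H2] := (stable_meas Xmu cK mE).2 kap kap0.
exists (Num.min e0 (Num.min e1 e2)); first by rewrite !lt_min e00 e10.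
move=> b nu s lc n0 /andP[s_gt0]; rewrite !lt_min -!andbA => /and4P[se0 se1 se2 sb].
have s0 := ltW s_gt0.
have s00 : 0 <= (0 : R) <= s by rewrite lexx.
have ss : 0 <= s <= s by rewrite s0 lexx.
have inb t : 0 <= t <= s -> 0 <= t <= b.
  by move=> /andP[-> ts]; rewrite (le_trans ts)// ltW.
have dist t t' : 0 <= t <= s -> 0 <= t' <= s -> `|t - t'| <= s.
  by move=> /andP[? ?] /andP[? ?]; rewrite ler_norml; apply/andP; split; lra.
have hn : moving_curve s nu.
  move=> t t' r ts ts'.
  exact: (lip_curve_moves Xmu hh lc (inb _ ts) (inb _ ts')).
have [_ Xn _] := lc.
have Mn t (ts : 0 <= t <= s) : inM mu (nu t) := (Xn t (inb t ts)).1.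
have mS := supp_meas Xmu eta.
(* Up to the time [e0] the curve stays in [K], since it conserves its mass. *)
have Kn t : 0 <= t <= s -> nu t (~` K) = 0%E.
  move=> ts; have [fn _ _] := Mn t ts; apply: full_null => //.
  rewrite (moving_curve_mass hn ts) n0//.
  rewrite -(full_nbd Xmu mS (@subset_refl _ _)) -(n0 _ mS).
  have mv : moves e0 (nu 0) (nu t).
    by apply: hn => //; apply: le_lt_trans se0; exact: dist.
  have [h1 _] := mv _ mS; apply: le_trans h1 _.
  by apply: meas_mono => //; exact: nbd_meas.
have dom al t : 0 <= t <= s -> (forall A, measurable A -> (al A <= nu t A)%E) ->
    carried mu K al.
  move=> ts an; split.
    by move=> A mA; apply: le_trans (an _ mA) _; have [_ _] := Mn t ts; exact.
  by apply: (le_null an); [exact: measurableC|exact: Kn].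
have [al [be [ab aE bE]]] := restr_split (nu 0) mE.
have [A [B [hA hB AB A0 B0]]] := moving_curve_split Xmu s0 hn Mn ab.
have MA t (ts : 0 <= t <= s) : inM mu (A t).
  by apply: (inM_le Xmu _ (Mn t ts)) => A'; exact: addm_lel (AB t ts).
have MB t (ts : 0 <= t <= s) : inM mu (B t).
  by apply: (inM_le Xmu _ (Mn t ts)) => A'; exact: addm_ler (AB t ts).
have [A1 [A2 [hA1 hA2 AA A1E A2E]]] := moving_curve_split_end s0 hA MA mE.
have [B1 [B2 [hB1 hB2 BB B1E B2E]]] := moving_curve_split_end s0 hB MB mE.
have leA t A' : 0 <= t <= s -> measurable A' -> (A t A' <= nu t A')%E.
  by move=> ts; exact: addm_lel (AB t ts).
have leB t A' : 0 <= t <= s -> measurable A' -> (B t A' <= nu t A')%E.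
  by move=> ts; exact: addm_ler (AB t ts).
have leA1 t A' : 0 <= t <= s -> measurable A' -> (A1 t A' <= A t A')%E.
  by move=> ts; exact: addm_lel (AA t ts).
have leA2 t A' : 0 <= t <= s -> measurable A' -> (A2 t A' <= A t A')%E.
  by move=> ts; exact: addm_ler (AA t ts).
have leB1 t A' : 0 <= t <= s -> measurable A' -> (B1 t A' <= B t A')%E.
  by move=> ts; exact: addm_lel (BB t ts).
have leB2 t A' : 0 <= t <= s -> measurable A' -> (B2 t A' <= B t A')%E.
  by move=> ts; exact: addm_ler (BB t ts).
have MA1 t (ts : 0 <= t <= s) : inM mu (A1 t).
  by apply: (inM_le Xmu _ (MA t ts)) => A'; exact: leA1.
have MA2 t (ts : 0 <= t <= s) : inM mu (A2 t).
  by apply: (inM_le Xmu _ (MA t ts)) => A'; exact: leA2.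
have MB1 t (ts : 0 <= t <= s) : inM mu (B1 t).
  by apply: (inM_le Xmu _ (MB t ts)) => A'; exact: leB1.
have MB2 t (ts : 0 <= t <= s) : inM mu (B2 t).
  by apply: (inM_le Xmu _ (MB t ts)) => A'; exact: leB2.
have mEC : measurable (~` E) by exact: measurableC.
have A0E : A 0 (~` E) = 0%E by rewrite A0.
have B0E : B 0 E = 0%E by rewrite B0.
have A10E : A1 0 (~` E) = 0%E by apply: (le_null _ mEC A0E) => A'; exact: leA1.
have A20E : A2 0 (~` E) = 0%E by apply: (le_null _ mEC A0E) => A'; exact: leA2.
have B10E : B1 0 E = 0%E by apply: (le_null _ mE B0E) => A'; exact: leB1.
have B20E : B2 0 E = 0%E by apply: (le_null _ mE B0E) => A'; exact: leB2.
have domA1 t (ts : 0 <= t <= s) : carried mu K (A1 t).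
  by apply: (dom _ _ ts) => A' mA'; apply: le_trans (leA1 _ _ ts mA') (leA _ _ ts mA').
have domA2 t (ts : 0 <= t <= s) : carried mu K (A2 t).
  by apply: (dom _ _ ts) => A' mA'; apply: le_trans (leA2 _ _ ts mA') (leA _ _ ts mA').
have domB1 t (ts : 0 <= t <= s) : carried mu K (B1 t).
  by apply: (dom _ _ ts) => A' mA'; apply: le_trans (leB1 _ _ ts mA') (leB _ _ ts mA').
have domB t (ts : 0 <= t <= s) : carried mu K (B t).
  by apply: (dom _ _ ts) => A' mA'; exact: leB.
have toR (f : X -> R) al' : L1loc mu f -> inM mu al' ->
    (\int[al']_x (f x)%:E)%E = (\int[al']_x f x)%:E.
  move=> Lf Ma; rewrite /Rintegral fineK//.
  exact: integrable_fin_num (L1loc_integrable Xmu Lf Ma).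
have inc1 (P : R -> meas) : moving_curve s P -> (forall t, 0 <= t <= s -> inM mu (P t)) ->
    (forall t, 0 <= t <= s -> carried mu K (P t)) ->
    `|\int[P s]_x k x - \int[P 0]_x k x| <= (\int[P 0]_x g x + dl / 3) * s.
  move=> hP MP dP; apply: (increment Xmu hh kgk) => // t ts.
  have mv : moves e1 (P 0) (P t).
    by apply: hP => //; apply: le_lt_trans se1; exact: dist.
  have := H1 _ _ (dP 0 s00) (dP t ts) mv.
  by rewrite (toR g _ Lg' (MP t ts)) (toR g _ Lg' (MP 0 s00)) -EFinD lee_fin.
have inc2 : `|\int[B1 s]_x k x - \int[B1 0]_x k x| <= dl / 3 * s.
  apply: (increment Xmu hh kgk) => // t ts.
  have B1T : (B1 t setT <= kap%:E)%E.
    rewrite (moving_curve_mass hB1 ts) -(moving_curve_mass hB1 ss).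
    apply: (@le_trans _ _ (B1 s E)).
      rewrite -(setUv E); apply: le_trans (meas_setU2 _ mE mEC) _.
      by rewrite B1E adde0.
    apply: le_trans (leB1 _ _ ss mE) _.
    have mv : moves e2 (B 0) (B s).
      by apply: hB => //; apply: le_lt_trans se2; exact: dist.
    by have := H2 _ _ (domB 0 s00) (domB s ss) mv; rewrite B0E add0e.
  have := Hk _ (domB1 t ts) B1T.
  by rewrite (toR g _ Lg' (MB1 t ts)) lee_fin.
have iA1 := inc1 A1 hA1 MA1 domA1.
have iA2 := inc1 A2 hA2 MA2 domA2.
have mass (P : R -> meas) : moving_curve s P -> P 0 setT = P s setT.
  by move=> hP; rewrite (moving_curve_mass hP ss).
have pA1 := phi_increment (MA1 0 s00) (MA1 s ss) (mass _ hA1) (or_intror A10E) (or_intror A1E).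
have pA2 := phi_increment (MA2 0 s00) (MA2 s ss) (mass _ hA2) (or_intror A20E) (or_introl A2E).
have pB1 := phi_increment (MB1 0 s00) (MB1 s ss) (mass _ hB1) (or_introl B10E) (or_intror B1E).
have pB2 : \int[B2 s]_x phi x = \int[B2 0]_x phi x.
  by rewrite !phi_above// (mass _ hB2).
have dec (f : X -> R) t : L1loc mu f -> 0 <= t <= s ->
    \int[nu t]_x f x = \int[A1 t]_x f x + \int[A2 t]_x f x +
                      (\int[B1 t]_x f x + \int[B2 t]_x f x).
  move=> Lf ts; rewrite (addm_integral (AB t ts));
    [|exact: (L1loc_integrable Xmu Lf (MA t ts))|exact: (L1loc_integrable Xmu Lf (MB t ts))].
  rewrite (addm_integral (AA t ts));
    [|exact: (L1loc_integrable Xmu Lf (MA1 t ts))|exact: (L1loc_integrable Xmu Lf (MA2 t ts))].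
  by rewrite (addm_integral (BB t ts));
    [|exact: (L1loc_integrable Xmu Lf (MB1 t ts))|exact: (L1loc_integrable Xmu Lf (MB2 t ts))].
have gA : \int[A1 0]_x g x + \int[A2 0]_x g x <= \int[eta]_x (`|gk x| * \1_E x).
  have LgE : L1loc mu (fun x => g x * \1_E x) by exact: L1loc_restr.
  rewrite -(addm_integral (AA 0 s00));
    [|exact: (L1loc_integrable Xmu Lg' (MA1 0 s00))|exact: (L1loc_integrable Xmu Lg' (MA2 0 s00))].
  have -> : \int[A 0]_x g x = \int[A 0]_x (g x * \1_E x).
    apply: (eq_off_integral (A := ~` E)) => //; [exact: Lg'.1|exact: LgE.1|].
    by move=> x /contrapT Ex; rewrite indicE mem_set// mulr1.
  apply: le_measure_Rintegral.
  - by move=> x; rewrite mulr_ge0// indicE.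
  - by move=> A' mA'; rewrite -n0//; exact: leA.
  - exact: (L1loc_integrable Xmu LgE (MA 0 s00)).
  - exact: (L1loc_integrable Xmu LgE Meta).
rewrite -(eqm_integral phi n0) !dec// pB2.
set J := \int[eta]_x _ in gA *.
apply: (@le_trans _ _ ((\int[A1 0]_x g x + dl / 3) * s + (\int[A2 0]_x g x + dl / 3) * s
  + dl / 3 * s)); last first.
  by rewrite -!mulrDl ler_pM2r//; lra.
apply: (@le_trans _ _ (`|\int[A1 s]_x phi x - \int[A1 0]_x phi x| +
  `|\int[A2 s]_x phi x - \int[A2 0]_x phi x| +
  `|\int[B1 s]_x phi x - \int[B1 0]_x phi x|)); last first.
  by apply: lerD; [apply: lerD|]; [exact: le_trans iA1|exact: le_trans iA2|exact: le_trans inc2].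
apply: le_trans (lerD (ler_normD _ _) (lexx _)).
apply: le_trans (ler_normD _ _).
rewrite le_eqVlt; apply/orP; left; apply/eqP; congr `|_|; ring.
Qed.

End Truncation.

(** * Truncation: the equality *)

Section Final.
Context {R : realType} {d : measure_display} {X : measurableMetricType d R}.
Local Notation meas := {measure set X -> \bar R}.
Implicit Types (al be eta : meas) (A B : set X) (r : R).
Context (mu : meas) (Xmu : metric_measure_space mu).
Let borel := mms_borel Xmu.

(** The restriction of [mu] to [A] has empty support. *)
Lemma locally_null A : measurable A ->
  (forall x, exists2 U, open U /\ U x & mu (U `&` A) = 0%E) -> mu A = 0%E.
Proof.
move=> mA H; pose nu : meas := mrestr mu mA.
have supp0 : ~` supp nu = setT.
  apply/seteqP; split => // x _ sx.
  have [U [oU Ux] U0] := H x.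
  by have := sx U oU Ux; rewrite /nu /= /mrestr U0 ltxx.
by have := supp_null Xmu nu; rewrite supp0 /nu /= /mrestr setTI.
Qed.

(** The restrictions of [mu] to small pieces of the set [N] where the inequality
fails are admissible test measures; each of them must vanish. *)
Lemma ae_le_of_integral (f f' : X -> R) : L1loc mu f -> L1loc mu f' ->
  (forall eta, inX mu eta -> \int[eta]_x f x <= \int[eta]_x f' x) ->
  {ae mu, forall x, f x <= f' x}.
Proof.
move=> Lf Lf' H; pose N := [set x | f' x < f x].
have mN : measurable N by exact: lt_set_meas Lf'.1 Lf.1.
exists N; split => //; last by move=> x /= /negP; rewrite -ltNge.
apply: locally_null => // x.
have [K [e [cK e0 xK]]] := compact_nbd Xmu (@compact_set1 _ x).
pose U := nbd e [set x]; have oU : open U by exact: nbd_open.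
exists U; first by split => //; exact: sub_nbd.
have mU : measurable U by exact: (nbd_meas borel).
pose eta : meas := mrestr mu (measurableI _ _ mU mN).
have etaE A : eta A = mu (A `&` (U `&` N)) by [].
have eta_mu A : measurable A -> (eta A <= mu A)%E.
  by move=> mA; rewrite etaE; apply: meas_mono => //; apply: measurableI => //; exact: measurableI.
have mK := compact_borel borel cK.
have etaK : eta (~` K) = 0%E.
  rewrite etaE (_ : _ `&` _ = set0) ?measure0//.
  by apply/seteqP; split => // y [nK [/xK]].
have Meta : inM mu eta.
  split => //.
    rewrite etaE setTI; apply: le_lt_trans (compact_fin Xmu cK).
    apply: meas_mono => //; first exact: measurableI.
    by move=> y [/xK].
  apply: (subclosed_compact (@supp_closed _ _ _ _) cK).
  exact: (null_supp (compact_closed (@metric_hausdorff R X) cK) etaK).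
have -> : U `&` N = setT `&` (U `&` N) by rewrite setTI.
rewrite -etaE; apply: contrapT => etaT.
have Xeta : inX mu eta by split => //; apply/eqP.
have If := L1loc_integrable Xmu Lf Meta.
have If' := L1loc_integrable Xmu Lf' Meta.
pose u x := Num.max (f x - f' x) 0.
have mB : measurable_fun [set: X] (fun x => f x - f' x).
  by apply: measurable_funB; [exact: Lf.1|exact: Lf'.1].
have mu_ : measurable_fun [set: X] u by exact: measurable_maxr.
have u0 x' : 0 <= u x' by rewrite /u le_max lexx orbT.
have etaN : eta (~` N) = 0%E.
  rewrite etaE (_ : _ `&` _ = set0) ?measure0//.
  by apply/seteqP; split => // y [nN [_ Ny]].
have Iu : \int[eta]_x u x <= 0.
  rewrite (eq_off_integral (f' := fun x => f x - f' x) (A := ~` N))//.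
  - by rewrite RintegralB// subr_le0; exact: H.
  - exact: measurableC.
  - by move=> y /contrapT; rewrite /N/= => Ny; rewrite /u max_l// subr_ge0 ltW.
have Iui : eta.-integrable [set: X] (EFin \o u).
  apply: (le_integrable measurableT (g := EFin \o (fun x => f x - f' x))).
  - exact/measurable_EFinP.
  - move=> y _ /=; rewrite lee_fin ger0_norm// /u ge_max normr_ge0 andbT.
    exact: ler_norm.
  - exact: (integrableB measurableT If If').
have /ae_eq_integral_abs : (\int[eta]_x `|(EFin \o u) x| = 0)%E.
  rewrite (eq_integral (EFin \o u)); last by move=> y _ /=; rewrite ger0_norm.
  rewrite -(fineK (integrable_fin_num measurableT Iui)); congr EFin.
  by apply/eqP; rewrite eq_le; apply/andP; split; [exact: Iu|exact: Rintegral_ge0].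
move=> /(_ measurableT (measurable_int _ Iui)) [N' [mN' N'0 sub]].
apply: etaT; apply/eqP; rewrite eq_le measure_ge0 andbT.
rewrite -(setUv N); apply: le_trans (meas_setU2 _ mN (measurableC mN)) _.
rewrite etaN adde0 -N'0; apply: meas_mono => // y Ny.
apply: sub => /= /(_ I) [] /eqP; rewrite /u.
by rewrite (max_l (y := 0)) ?subr_ge0 ?(ltW Ny)// subr_eq0 gt_eqF.
Qed.

Context (h : R -> R) (hh : gauge h).

Lemma r_lim_ext (F F' : meas -> R) eta : inX mu eta ->
  (forall al be, inX mu al -> inX mu be -> `|F al - F be| = `|F' al - F' be|) ->
  r_lim mu h F eta = r_lim mu h F' eta.
Proof.
move=> Xeta.
suff half (F1 F2 : meas -> R) e :
    (forall al be, inX mu al -> inX mu be -> `|F1 al - F1 be| = `|F2 al - F2 be|) ->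
    (r_eps mu h F1 eta e <= r_eps mu h F2 eta e)%E.
  move=> FF; rewrite !r_limE; congr ereal_inf.
  have H e : r_eps mu h F eta e = r_eps mu h F' eta e.
    by apply/eqP; rewrite eq_le !half// => al be Xa Xb; rewrite FF.
  by apply/seteqP; split => _ [e e0 <-]; exists e => //; rewrite H.
move=> FF; apply: ereal_sup_le => _ [b [nu [s [lc n0 /andP[s0 sb] ->]]]].
have Xs : inX mu (nu s).
  have [_ Xn _] := lc; apply: Xn; move: sb; rewrite lt_min => /andP[_ sb].
  by rewrite (ltW s0) ltW.
by exists b, nu, s; rewrite s0 sb FF.
Qed.

Lemma Favg_opp (f : X -> R) al : L1loc mu f -> inM mu al ->
  Favg (fun x => - f x) al = - Favg f al.
Proof.
move=> Lf Ma; rewrite /Favg -mulrN; congr (_ * _).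
under eq_Rintegral do rewrite -mulN1r.
by rewrite RintegralZl ?mulN1r//; exact: (L1loc_integrable Xmu Lf Ma).
Qed.

Lemma L1loc_opp (f : X -> R) : L1loc mu f -> L1loc mu (fun x => - f x).
Proof.
move=> Lf; apply: (L1loc_bound Xmu (g := f) (C := 0)) => //.
  by apply: measurableT_comp => //; exact: Lf.1.
by move=> x; rewrite normrN addr0.
Qed.

(** The increments of [- k] have the same absolute values as those of [k]. *)
Lemma upper_gradient_opp (k gk : X -> R) : upper_gradient mu h k gk ->
  upper_gradient mu h (fun x => - k x) gk.
Proof.
move=> [Lk Lg ug]; split; [exact: L1loc_opp|exact: Lg|move=> eta Xeta].
rewrite -(ug eta Xeta); apply: (r_lim_ext Xeta) => al be [Ma _] [Mb _].
by rewrite (Favg_opp Lk Ma) (Favg_opp Lk Mb) -opprD normrN.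
Qed.

(** The function [F_f] has slope at most [J / eta(X)] at [eta]; masses are not
normalised here, since they are constant along curves. *)
Definition slope_le (f : X -> R) eta (J : R) := forall dl : R, 0 < dl ->
  exists2 e : R, 0 < e & forall b (nu : R -> meas) s, lip_curve mu h b nu ->
    eqm (nu 0) eta -> 0 < s < Num.min e b ->
    `|\int[nu s]_x f x - \int[eta]_x f x| <= (J + dl) * s.

Lemma slope_min (k gk : X -> R) c eta : upper_gradient mu h k gk -> inX mu eta ->
  slope_le (fun x => Num.min (k x) c) eta
    (\int[eta]_x (`|gk x| * \1_[set y | k y < c] x)).
Proof. by move=> kgk Xeta dl; exact: (upper_slope Xmu hh kgk c Xeta). Qed.

Lemma L1loc_max (k : X -> R) c : L1loc mu k -> L1loc mu (fun x => Num.max (k x) c).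
Proof.
move=> Lk; apply: (L1loc_bound Xmu (g := k) (C := `|c|)) => //.
  by apply: measurable_maxr => //; exact: Lk.1.
by move=> x; case: (leP (k x) c) => _; rewrite ?lerDl ?lerDr.
Qed.

(** The maximum is the minimum of the opposite numbers, and [- k] has the same
upper gradient. *)
Lemma slope_max (k gk : X -> R) c eta : upper_gradient mu h k gk -> inX mu eta ->
  slope_le (fun x => Num.max (k x) c) eta
    (\int[eta]_x (`|gk x| * \1_[set y | k y > c] x)).
Proof.
move=> kgk Xeta dl dl0; have [Lk _ _] := kgk.
have [e e0 H] := slope_min (- c) (upper_gradient_opp kgk) Xeta dl0.
exists e => // b nu s lc n0 sb; have := H b nu s lc n0 sb.
rewrite (_ : [set y | - k y < - c] = [set y | k y > c]); last first.
  by apply/seteqP; split => y /=; rewrite ltrN2.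
have opp al : inM mu al ->
    \int[al]_x Num.min (- k x) (- c) = - \int[al]_x Num.max (k x) c.
  move=> Ma; have I := L1loc_integrable Xmu (L1loc_max c Lk) Ma.
  transitivity (\int[al]_x (-1 * Num.max (k x) c)).
    by apply: eq_Rintegral => x _; rewrite mulN1r oppr_max.
  by rewrite (RintegralZl _ measurableT I) mulN1r.
have Ms : inM mu (nu s).
  have [_ Xn _] := lc; case/andP: sb => s0; rewrite lt_min => /andP[_ sb].
  by apply: (Xn s _).1; rewrite !ltW.
by rewrite !opp//; [rewrite -opprD normrN|exact: Xeta.1].
Qed.

Lemma lip_curve_mass b (nu : R -> meas) s t : lip_curve mu h b nu ->
  0 <= s <= b -> 0 <= t <= b -> nu s setT = nu t setT.
Proof.
move=> lc sb tb; have r0 : 0 < `|s - t| + 1 by rewrite ltr_wpDl.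
by apply: (moves_mass r0); apply: (lip_curve_moves Xmu hh lc) => //; rewrite ltrDl.
Qed.

(** The constant curve has slope 0. *)
Lemma r_lim_ge0 (F : meas -> R) eta : inX mu eta -> (0 <= r_lim mu h F eta)%E.
Proof.
move=> Xeta; apply: r_lim_ge => e e0; exists 1, (fun=> eta), (Num.min e 1 / 2).
have m0 : 0 < Num.min e 1 by rewrite lt_min e0 ltr01.
split => //.
- split => // s t _ _; apply: (moves_dM Xmu hh); [exact: Xeta.1|exact: Xeta.1|by []|].
  by move=> r r0; apply: (moves_refl borel); apply: le_lt_trans r0.
- by rewrite divr_gt0//= ltr_pdivrMr// mulr_natr mulr2n ltrDl.
- by rewrite mul0r.
Qed.

Lemma upper_gradient_ge0 (k gk : X -> R) : upper_gradient mu h k gk ->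
  {ae mu, forall x, 0 <= gk x}.
Proof.
move=> [_ Lg ug]; apply: (ae_le_of_integral (f := cst 0)) => //.
  apply: (L1loc_bound Xmu (g := gk) (C := 0)) => // x.
  by rewrite normr0 addr0.
move=> eta Xeta; rewrite Rintegral_cst// mul0r.
have := r_lim_ge0 (Favg k) Xeta; rewrite ug// lee_fin /Favg.
have [[fe _ _] e0] := Xeta.
have m0 : 0 < fine (eta setT) by rewrite fine_gt0// fe lt0e e0 measure_ge0.
by rewrite pmulr_rge0 ?invr_gt0.
Qed.

(** The increments of [f1] and [f2] along a curve add up to the increment of [k].
Along curves that realise the slope of [k], which is the integral of [gk], there
is no room left between the bounds [J1] and [J2] and the actual increments, so
the bound for [f1] is attained. *)
Lemma r_lim_complementary (k gk f1 f2 : X -> R) (c J1 J2 : R) eta :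
  upper_gradient mu h k gk -> inX mu eta -> L1loc mu f1 -> L1loc mu f2 ->
  (forall x, f1 x + f2 x = k x + c) ->
  slope_le f1 eta J1 -> slope_le f2 eta J2 -> J1 + J2 <= \int[eta]_x gk x ->
  r_lim mu h (Favg f1) eta = ((fine (eta setT))^-1 * J1)%:E.
Proof.
move=> [Lk Lg ug] Xeta L1 L2 fk s1 s2 JJ.
have [[fe _ _] eT] := Xeta; have Me := Xeta.1.
pose m := fine (eta setT).
have m0 : 0 < m by rewrite fine_gt0// fe lt0e eT measure_ge0.
have im0 : 0 < m^-1 by rewrite invr_gt0.
have facts b (nu : R -> meas) s e : lip_curve mu h b nu -> eqm (nu 0) eta ->
    0 < s < Num.min e b -> [/\ 0 < s, s < e, inM mu (nu s) & nu s setT = eta setT].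
  move=> lc n0 /andP[s0]; rewrite lt_min => /andP[se sb].
  have [b0 Xn _] := lc; have ss : 0 <= s <= b by rewrite !ltW.
  split => //; first exact: (Xn s ss).1.
  by rewrite -n0//; apply: (lip_curve_mass lc) => //; rewrite lexx.
have Fdiff (f : X -> R) al : al setT = eta setT ->
    Favg f al - Favg f eta = m^-1 * (\int[al]_x f x - \int[eta]_x f x).
  by move=> E; rewrite /Favg E -mulrBr.
apply/eqP; rewrite eq_le; apply/andP; split; apply/lee_addgt0Pr => dl dl0.
- have md0 : 0 < m * dl by rewrite mulr_gt0.
  have [e e0 H] := s1 _ md0.
  rewrite -EFinD; apply: (r_lim_le e0) => b nu s lc n0 sb.
  have [s0 _ _ mE] := facts _ _ _ _ lc n0 sb.
  rewrite Fdiff// normrM (gtr0_norm im0).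
  have := H b nu s lc n0 sb; rewrite -(ler_pM2l im0) => H'; apply: le_trans H' _.
  by rewrite mulrA mulrDr mulKf// gt_eqF.
- rewrite -leeBlDr// -EFinB; apply: r_lim_ge => e e0.
  have md2 : 0 < m * dl / 2 by rewrite divr_gt0// mulr_gt0.
  have [e2 e20 H2] := s2 _ md2.
  have ee0 : 0 < Num.min e e2 by rewrite lt_min e0.
  have lt : ((m^-1 * (\int[eta]_x gk x - m * dl / 2))%:E < r_lim mu h (Favg k) eta)%E.
    by rewrite ug// lte_fin /Favg ltr_pM2l// ltrBlDr ltrDl.
  have [b [nu [s [lc n0 sb Hk]]]] := r_lim_witness ee0 lt.
  exists b, nu, s.
  have [s0 se Ms mE] := facts _ _ _ _ lc n0 sb.
  have sb1 : 0 < s < Num.min e b.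
    by move: sb; rewrite s0 !lt_min/= -andbA => /and3P[-> _ ->].
  have sb2 : 0 < s < Num.min e2 b.
    by move: sb; rewrite s0 !lt_min/= -andbA => /and3P[_ -> ->].
  split => //; rewrite Fdiff// normrM (gtr0_norm im0).
  move: Hk; rewrite Fdiff// normrM (gtr0_norm im0).
  rewrite -[X in X < _ -> _]mulrA ltr_pM2l// => Hk.
  have h2 := H2 b nu s lc n0 sb2.
  have -> : (m^-1 * J1 - dl) * s = m^-1 * ((J1 - m * dl) * s).
    by rewrite mulrA mulrBr mulKf// gt_eqF.
  rewrite ler_pM2l//.
  have sum al : inM mu al -> al setT = eta setT ->
      \int[al]_x k x = \int[al]_x f1 x + \int[al]_x f2 x - c * m.
    move=> Ma aE.
    have Lc : L1loc mu (cst c : X -> R).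
      by apply: (L1loc_bound Xmu (g := k) (C := `|c|)) => // x; rewrite lerDr.
    have I1 := L1loc_integrable Xmu L1 Ma; have I2 := L1loc_integrable Xmu L2 Ma.
    have Ik := L1loc_integrable Xmu Lk Ma; have Ic := L1loc_integrable Xmu Lc Ma.
    rewrite -RintegralD//; under [X in _ = X - _]eq_Rintegral do rewrite fk.
    by rewrite RintegralD// Rintegral_cst// aE addrK.
  rewrite (sum _ Ms mE) (sum _ Me erefl) in Hk.
  move: Hk h2; set a := \int[nu s]_x f1 x; set b1 := \int[nu s]_x f2 x.
  set a' := \int[eta]_x f1 x; set b' := \int[eta]_x f2 x; set J := \int[eta]_x gk x in JJ *.
  have -> : a + b1 - c * m - (a' + b' - c * m) = (a - a') + (b1 - b') by ring.
  move=> Hk h2; have := ler_normD (a - a') (b1 - b') => h3.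
  have JJs : (J1 + J2) * s <= J * s by rewrite ler_pM2r.
  move: (`|a - a'|) (`|b1 - b'|) (`|_|) Hk h2 h3 => N1 N2 N3; lra.
Qed.

End Final.

Unset Implicit Arguments.

Theorem theorem6p20 (R : realType) (d : measure_display)
    (X : measurableMetricType d R) (mu : {measure set X -> \bar R})
    (Xmu : metric_measure_space mu)
    (h : R -> R) (hh : gauge h)
    (k gk : X -> R) (kgk : upper_gradient mu h k gk) (c : R) :
  upper_gradient_is mu h (fun x => Num.min (k x) c)
    (fun x => gk x * \1_[set y | k y < c] x) /\
  upper_gradient_is mu h (fun x => Num.max (k x) c)
    (fun x => gk x * \1_[set y | k y > c] x).
Proof.
have [Lk Lg ug] := kgk.
have mlt : measurable [set y | k y < c] by exact: lt_set_meas Lk.1 _.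
have mgt : measurable [set y | k y > c] by exact: lt_set_meas _ Lk.1.
have Lmin : L1loc mu (fun x => Num.min (k x) c) := L1loc_min Xmu kgk c.
have Lmax := L1loc_max Xmu c Lk.
have Ll : L1loc mu (fun x => gk x * \1_[set y | k y < c] x) by exact: L1loc_restr.
have Lr : L1loc mu (fun x => gk x * \1_[set y | k y > c] x) by exact: L1loc_restr.
have [N [mN N0 sub]] := upper_gradient_ge0 Xmu hh kgk.
have gN x : ~ N x -> `|gk x| = gk x.
  by move=> nN; apply: ger0_norm; apply: contrapT => nx; apply: nN; exact: sub.
have etaN eta : inX mu eta -> eta N = 0%E.
  move=> [[_ _ em] _]; apply/eqP; rewrite eq_le measure_ge0 andbT -N0; exact: em.
have Labs (A : set X) : measurable A -> L1loc mu (fun x => `|gk x| * \1_A x).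
  by move=> mA; apply: L1loc_restr => //; exact: L1loc_abs.
have absE (A : set X) eta : measurable A -> inX mu eta ->
    \int[eta]_x (`|gk x| * \1_A x) = \int[eta]_x (gk x * \1_A x).
  move=> mA Xeta; apply: (eq_off_integral (A := N)) => //.
  - exact: (Labs A mA).1.
  - exact: (L1loc_restr Xmu mA Lg).1.
  - exact: etaN.
  - by move=> x /gN ->.
have JJ eta : inX mu eta -> \int[eta]_x (`|gk x| * \1_[set y | k y < c] x) +
    \int[eta]_x (`|gk x| * \1_[set y | k y > c] x) <= \int[eta]_x gk x.
  move=> Xeta; have Me := Xeta.1.
  have -> : \int[eta]_x gk x = \int[eta]_x `|gk x|.
    apply: (eq_off_integral (A := N)) => //; [exact: Lg.1| |exact: etaN|by move=> x /gN].
    by apply: measurableT_comp => //; exact: Lg.1.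
  rewrite -RintegralD//; [|exact: (L1loc_integrable Xmu (Labs _ mlt) Me)
    |exact: (L1loc_integrable Xmu (Labs _ mgt) Me)].
  apply: le_Rintegral => //.
  - exact: (integrableD measurableT (L1loc_integrable Xmu (Labs _ mlt) Me)
      (L1loc_integrable Xmu (Labs _ mgt) Me)).
  - exact: (L1loc_integrable Xmu (L1loc_abs Xmu Lg) Me).
  - move=> x _; rewrite -mulrDr ler_piMr// !indicE.
    have [kc|] := ltP (k x) c.
      rewrite (memNset (A := [set y | c < k y])) ?addr0; last by move=> /=; rewrite ltNge ltW.
      by case: (_ \in _).
    rewrite leNgt => /negP kc; rewrite memNset// add0r; by case: (_ \in _).
have uniq (f g g' : X -> R) : L1loc mu g ->
    (forall eta, inX mu eta -> r_lim mu h (Favg f) eta = (Favg g eta)%:E) ->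
    upper_gradient mu h f g' -> {ae mu, forall x, g' x = g x}.
  move=> Lg1 H [_ Lg' H'].
  have E eta : inX mu eta -> \int[eta]_x g' x = \int[eta]_x g x.
    move=> Xeta; have := H eta Xeta; rewrite H'// => -[]; rewrite /Favg.
    have [[fe _ _] eT] := Xeta.
    have m0 : 0 < fine (eta setT) by rewrite fine_gt0// fe lt0e eT measure_ge0.
    by apply: mulfI; rewrite invr_eq0 gt_eqF.
  have ae1 : {ae mu, forall x, g' x <= g x}.
    by apply: (ae_le_of_integral Xmu) => // eta Xeta; rewrite E.
  have ae2 : {ae mu, forall x, g x <= g' x}.
    by apply: (ae_le_of_integral Xmu) => // eta Xeta; rewrite E.
  by apply: filterS2 ae1 ae2 => x h1 h2; apply/eqP; rewrite eq_le h1.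
have Hmin eta : inX mu eta -> r_lim mu h (Favg (fun x => Num.min (k x) c)) eta =
    (Favg (fun x => gk x * \1_[set y | k y < c] x) eta)%:E.
  move=> Xeta; rewrite /Favg -absE//.
  apply: (r_lim_complementary Xmu hh (c := c) kgk Xeta Lmin Lmax _
    (slope_min Xmu hh c kgk Xeta) (slope_max Xmu hh c kgk Xeta) (JJ _ Xeta)).
  by move=> x; rewrite addr_min_max.
have Hmax eta : inX mu eta -> r_lim mu h (Favg (fun x => Num.max (k x) c)) eta =
    (Favg (fun x => gk x * \1_[set y | k y > c] x) eta)%:E.
  move=> Xeta; rewrite /Favg -absE//.
  apply: (r_lim_complementary Xmu hh (c := c) kgk Xeta Lmax Lmin _
    (slope_max Xmu hh c kgk Xeta) (slope_min Xmu hh c kgk Xeta) _).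
    by move=> x; rewrite addrC addr_min_max.
  by rewrite addrC; exact: JJ.
split; split.
- by eexists; split; [exact: Lmin|exact: Ll|exact: Hmin].
- by move=> g'; exact: uniq Ll Hmin.
- by eexists; split; [exact: Lmax|exact: Lr|exact: Hmax].
- by move=> g'; exact: uniq Lr Hmax.
Qed.
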